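(* Let $\nu$ be a charge on $\mathbb{C}$ of finite type at order $p\in\mathbb{R}^+$ near $\infty$, $q=[p]$, and suppose $D(r_0)\cap\operatorname{supp}\nu=\varnothing$ for some $r_0>0$. Let $\nu^{\rm up}$ denote the restriction of $\nu$ to $\mathbb{C}^{\rm up}$. 1. The balayage $\nu^{\mathrm{bal}[q]}$ from $\mathbb{C}^{\rm up}$ exists and there is a constant $C$ (depending on $\nu,p$) such that for all $r\ge0$ $$|\nu^{\mathrm{bal}[q]}|^{\rm rad}(r)\le C\Bigl(r^p+r^q\Bigl|\int_{D(r)\setminus D(r_0)}\operatorname{Im}\frac1{z^q}d\nu^{\rm up}(z)\Bigr|\Bigr).$$ 2. For every $p\in\mathbb{R}^+$, $|\nu^{\mathrm{bal}[q]}|^{\rm rad}(r)=O(r^p\log r)$ as $r\to+\infty$. 3. If $p\notin\mathbb{N}_0$, then $\nu^{\mathrm{bal}[q]}$ is of finite type at order $p$. 4. If $p\in\mathbb{N}_0$ (so $q=p$) and $\bigl|\int_{D(t)\setminus D(r_0)}\operatorname{Im}\frac1{z^p}d\nu^{\rm up}(z)\bigr|=O(1)$ as $t\to+\infty$, then $\nu^{\mathrm{bal}[p]}$ is of finite type at order $p$.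
   Context: A charge is a real Borel signed measure on $\mathbb{C}$ finite on bounded sets; $|\nu|$ total variation; $|\nu|^{\rm rad}(r)=|\nu|(\{|z|\le r\})$; $\nu$ is of finite type at order $p$ if $\limsup_{r\to\infty}|\nu|^{\rm rad}(r)/r^p<\infty$. $D(r)=\{|z|<r\}$, $\mathbb{C}^{\rm up}=\{\operatorname{Im}z>0\}$. For $z\in\mathbb{C}^{\rm up}$ and bounded Borel $B$: $\Omega^{[q]}(z,B)=\frac1\pi\int_{B\cap\mathbb{R}}\operatorname{Im}\frac1{t-z}dt+\frac1\pi\sum_{k=1}^q\operatorname{Im}(z^{-k})\int_{B\cap\mathbb{R}}t^{k-1}dt$; $\nu^{\mathrm{bal}[q]}(B)=\int_{\mathbb{C}^{\rm up}}\Omega^{[q]}(z,B)d\nu(z)+\nu(B\setminus\mathbb{C}^{\rm up})$. *)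

(* Defs.v *)
From HB Require Import structures.
From mathcomp Require Import all_boot all_order all_algebra.
From mathcomp Require Import all_classical all_reals all_analysis.
From mathcomp Require Import complex.
Set Implicit Arguments. Unset Strict Implicit. Unset Printing Implicit Defensive.
Import Order.TTheory GRing.Theory Num.Theory.
Import numFieldNormedType.Exports.
Local Open Scope classical_set_scope.
Local Open Scope ring_scope.

Section Defs.
Variable R : realType.
(* The complex plane is modelled as R * R (product = Borel sigma-algebra);
   a point z is (Re z, Im z). *)
Local Notation P := (R * R)%type.

Definition toC (z : P) : complex.complex R := complex.Complex z.1 z.2.
Definition sqmod (z : P) : R := z.1 ^+ 2 + z.2 ^+ 2.

Definition odisc (r : R) : set P := [set z | sqmod z < r ^+ 2].
Definition cdisc (r : R) : set P := [set z | sqmod z <= r ^+ 2].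
Definition oball (w : P) (e : R) : set P :=
  [set z | (z.1 - w.1) ^+ 2 + (z.2 - w.2) ^+ 2 < e ^+ 2].
Definition upper : set P := [set z | 0 < z.2].
Definition bounded_set (B : set P) : Prop := exists r : R, B `<=` cdisc r.

(* A charge nu is given through its Jordan decomposition nu = mup - mun into two
   mutually singular positive Borel measures, finite on bounded sets. *)
Definition locfin (mu : {measure set P -> \bar R}) : Prop :=
  forall r : R, (mu (cdisc r) < +oo)%E.
Definition mutsing (mup mun : {measure set P -> \bar R}) : Prop :=
  exists A : set P, [/\ measurable A, mup A = 0%E & mun (~` A) = 0%E].

Definition chg (mup mun : {measure set P -> \bar R}) (B : set P) : R :=
  fine (mup B) - fine (mun B).
Definition chg_int (mup mun : {measure set P -> \bar R}) (D : set P) (f : P -> R) : R :=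
  Rintegral mup D f - Rintegral mun D f.

Definition tvar (m : set P -> R) (A : set P) : \bar R :=
  ereal_sup [set x : \bar R | exists (n : nat) (F : 'I_n -> set P),
    [/\ forall i, measurable (F i), forall i, F i `<=` A,
        forall i j, i != j -> F i `&` F j = set0 &
        x = ((\sum_(i < n) `|m (F i)|)%:E)]].

Definition tv_rad (m : set P -> R) (r : R) : \bar R := tvar m (cdisc r).

Definition finite_type (m : set P -> R) (p : R) : Prop :=
  exists C : R, \forall r \near +oo, (tv_rad m r <= (C * r `^ p)%:E)%E.

Definition supp (mup mun : {measure set P -> \bar R}) : set P :=
  [set w | forall e : R, 0 < e -> tvar (chg mup mun) (oball w e) != 0%E].

Definition realpart (B : set P) : set R := [set t | B (t, 0)].

Definition Omega (q : nat) (z : P) (B : set P) : R :=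
  pi^-1 * Rintegral lebesgue_measure (realpart B)
            (fun t : R => complex.Im ((complex.Complex t 0 - toC z)^-1))
  + pi^-1 * \sum_(1 <= k < q.+1)
      complex.Im ((toC z ^+ k)^-1) *
      Rintegral lebesgue_measure (realpart B) (fun t : R => t ^+ k.-1).

Definition bal_exists (mup mun : {measure set P -> \bar R}) (q : nat) : Prop :=
  forall B : set P, measurable B -> bounded_set B ->
    mup.-integrable upper (fun z => (Omega q z B)%:E) /\
    mun.-integrable upper (fun z => (Omega q z B)%:E).

Definition bal (mup mun : {measure set P -> \bar R}) (q : nat) (B : set P) : R :=
  chg_int mup mun upper (fun z => Omega q z B) + chg mup mun (B `\` upper).

Definition int_up (mup mun : {measure set P -> \bar R}) (q : nat) (r0 r : R) : R :=
  chg_int mup mun ((odisc r `\` odisc r0) `&` upper)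
    (fun z => complex.Im ((toC z ^+ q)^-1)).

End Defs.

(* Main.v *)
(** Multiplying out the finite geometric series in the definition of the kernel
    shows that the density of [Omega q z] at [t] is the imaginary part of
    [(t / z) ^ q / (t - z)] (up to the factor [1 / pi]), which is at most
    [2 r^q / |z|^(q+1)] when [|t| <= r] and [2 r <= |z|]. To estimate the variation
    of the balayage on the disc of radius [r], split the upper half plane at
    [|z| = 2 r]. Far away this bound is integrable against [|nu|], since
    [p < q + 1], and contributes [O(r^p)]. Close by, the Poisson part has mass at
    most [1] for each [z], and the remaining terms are the moments of [Im z^(-k)]
    times integrals of powers of [t]. The moments with [k < q] contribute
    [O(r^p)], by a dyadic decomposition; the one with [k = q] differs from the
    integral over [D(r)] by the contribution of one dyadic shell, and is the only
    term that can exceed [O(r^p)]. *)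

Require Import Defs.
From HB Require Import structures.
From mathcomp Require Import all_boot all_order all_algebra.
From mathcomp Require Import all_classical all_reals all_analysis.
From mathcomp Require Import complex.
From mathcomp Require Import measurable_realfun.
From mathcomp Require Import ring lra.
Set Implicit Arguments.
Unset Strict Implicit.
Unset Printing Implicit Defensive.
Import Order.TTheory GRing.Theory Num.Theory.
Import numFieldNormedType.Exports.
Local Open Scope classical_set_scope.
Local Open Scope ring_scope.

(** * Kernels in the plane *)

Section Plane.
Variable R : realType.
Local Notation P := (R * R)%type.
Implicit Types (z w : P) (r t : R).

Definition nrm z : R := Num.sqrt (sqmod z).

Lemma sqmod_ge0 z : 0 <= sqmod z.
Proof. by rewrite addr_ge0// sqr_ge0. Qed.

Lemma nrm_ge0 z : 0 <= nrm z.
Proof. exact: sqrtr_ge0. Qed.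

Lemma nrmE z : nrm z = Normc.normc (toC z).
Proof. by []. Qed.

Lemma sqr_nrm z : nrm z ^+ 2 = sqmod z.
Proof. by rewrite sqr_sqrtr// sqmod_ge0. Qed.

Lemma in_cdisc r z : 0 <= r -> cdisc r z <-> nrm z <= r.
Proof.
move=> r0; rewrite /cdisc /= -sqr_nrm; split=> h.
  by rewrite -(@ler_pXn2r _ 2)// ?nnegrE// nrm_ge0.
by rewrite ler_pXn2r// ?nnegrE// nrm_ge0.
Qed.

Lemma in_odisc r z : 0 <= r -> odisc r z <-> nrm z < r.
Proof.
move=> r0; rewrite /odisc /= -sqr_nrm; split=> h.
  by rewrite -(@ltr_pXn2r _ 2)// ?nnegrE// nrm_ge0.
by rewrite ltr_pXn2r// ?nnegrE// nrm_ge0.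
Qed.

Lemma nrm_upper z : 0 < z.2 -> 0 < nrm z.
Proof.
move=> z0; rewrite sqrtr_gt0 /sqmod ltr_wpDl ?sqr_ge0//.
by rewrite exprn_gt0.
Qed.

Lemma normr_Im_le (x : complex.complex R) : `|complex.Im x| <= Normc.normc x.
Proof.
case: x => a b /=.
by rewrite -sqrtr_sqr ler_wsqrtr// lerDr sqr_ge0.
Qed.

Lemma normcX (x : complex.complex R) n : Normc.normc (x ^+ n) = Normc.normc x ^+ n.
Proof.
elim: n => [|n IHn]; first by rewrite !expr0 Normc.normc1.
by rewrite !exprS Normc.normcM IHn.
Qed.

Lemma normr_ImV_le k z : `|complex.Im ((toC z ^+ k)^-1)| <= nrm z ^- k.
Proof.
by apply: (le_trans (normr_Im_le _)); rewrite Normc.normcV normcX nrmE.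
Qed.

(** This is pi times the Poisson kernel of the upper half plane, kept in the complex form in which
    the geometric series can be summed. *)
Definition pker z t : R := complex.Im ((complex.Complex t 0 - toC z)^-1).

Definition cker q z t : R :=
  pker z t + \sum_(1 <= k < q.+1) complex.Im ((toC z ^+ k)^-1) * t ^+ k.-1.

Lemma pkerE z t : pker z t = z.2 / ((t - z.1) ^+ 2 + z.2 ^+ 2).
Proof.
rewrite /pker /toC; case: z => x y /=.
by rewrite sub0r sqrrN mulNr opprK.
Qed.

Lemma toC_neq0 z : 0 < nrm z -> toC z != 0.
Proof. by apply: contraTneq => e; rewrite nrmE e Normc.normc0 ltxx. Qed.

Lemma Im_mulr (a : R) (x : complex.complex R) :
  complex.Im x * a = complex.Im (x * complex.Complex a 0).
Proof. by case: x => b c /=; rewrite mulr0 add0r. Qed.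

Lemma CRX t n : complex.Complex t 0 ^+ n = complex.Complex (t ^+ n) 0.
Proof.
elim: n => [//|n IHn]; rewrite !exprS IHn.
by apply/eqP; rewrite eq_complex /= !mulr0 !mul0r subr0 addr0 !eqxx.
Qed.

(* Telescoping: adding [t^q / z^(q+1)] to [(t/z)^q / (t - z)] gives
   [(t/z)^(q+1) / (t - z)]. *)
Lemma ckerE q z t : 0 < z.2 ->
  cker q z t = complex.Im ((complex.Complex t 0 / toC z) ^+ q
                           / (complex.Complex t 0 - toC z)).
Proof.
move=> z0; have zn0 := toC_neq0 (nrm_upper z0).
have dn0 : complex.Complex t 0 - toC z != 0.
  rewrite /toC; case: z z0 {zn0} => x y /= y0.
  by rewrite eq_complex /= sub0r oppr_eq0 (gt_eqF y0) andbF.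
elim: q => [|q IHq].
  by rewrite /cker big_geq// addr0 expr0 mul1r.
rewrite /cker big_nat_recr//= addrA -/(cker q z t) IHq Im_mulr -CRX -raddfD /=.
congr complex.Im; move: dn0; set u := complex.Complex t 0 => dn0.
rewrite !exprMn !exprVn !exprS.
have zq : toC z ^+ q != 0 by rewrite expf_neq0.
by field; rewrite zq zn0 dn0.
Qed.

(** Since |t| <= r <= |z| / 2, the triangle inequality gives |t - z| >= |z| / 2. This is the source
    of the factor 2, and the gain of a full power of |z| comes from the closed form [ckerE]. *)
Lemma cker_far q z t r : 0 < z.2 -> `|t| <= r -> 2 * r <= nrm z ->
  `|cker q z t| <= 2 * r ^+ q / nrm z ^+ q.+1.
Proof.
move=> z0 tr rz; have n0 := nrm_upper z0.
have r0 : 0 <= r by apply: le_trans tr.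
rewrite ckerE//; apply: (le_trans (normr_Im_le _)).
rewrite Normc.normcM Normc.normcV normcX Normc.normcM Normc.normcV -nrmE.
have nt : Normc.normc (complex.Complex t 0) = `|t|.
  by rewrite /= expr0n/= addr0 sqrtr_sqr.
have tri : nrm z / 2 <= Normc.normc (complex.Complex t 0 - toC z).
  have := le_normcD (complex.Complex t 0) (toC z - complex.Complex t 0).
  rewrite addrC subrK -nrmE nt -normcN opprB; lra.
have h0 : 0 < nrm z / 2 by lra.
rewrite nt expr_div_n exprS invfM.
have -> : 2 * r ^+ q * ((nrm z)^-1 * (nrm z ^+ q)^-1)
   = r ^+ q / nrm z ^+ q * (nrm z / 2)^-1.
  by field; rewrite expf_neq0 ?gt_eqF.
apply: ler_pM => //.
- by rewrite divr_ge0// exprn_ge0// ltW.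
- by rewrite invr_ge0 (le_trans _ tri)// ltW.
- by rewrite ler_pM2r ?invr_gt0 ?exprn_gt0// lerXn2r// nnegrE.
- by rewrite lef_pV2// posrE (lt_le_trans h0).
Qed.

Lemma pker_ge0 z t : 0 < z.2 -> 0 <= pker z t.
Proof.
move=> z0; rewrite pkerE; apply: divr_ge0; first exact: ltW.
by rewrite addr_ge0// sqr_ge0.
Qed.

End Plane.

(** * Sums over disjoint families, and integrals of finite linear combinations *)

Section Packing.
Context d (T : measurableType d) (R : realType) (mu : {measure set T -> \bar R}).

(** Serves to bound variation sums independently of the number of pieces: additivity over the
    disjoint union, then monotonicity, as the integrand is nonnegative. *)
Lemma sum_Rintegral_le n (F : 'I_n -> set T) (D : set T) (f : T -> R) :
  measurable D -> (forall i, measurable (F i)) -> (forall i, F i `<=` D) ->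
  (forall i j, i != j -> F i `&` F j = set0) ->
  mu.-integrable D (EFin \o f) -> (forall x, D x -> 0 <= f x) ->
  \sum_(i < n) Rintegral mu (F i) f <= Rintegral mu D f.
Proof.
move=> mD mF FD dF intf f0.
have sD : \big[setU/set0]_(i < n) F i `<=` D.
  by apply: (big_ind (fun X => X `<=` D)) => // X Y XD YD x [/XD|/YD].
have mU : measurable (\big[setU/set0]_(i < n) F i) by apply: bigsetU_measurable.
have mf : measurable_fun D (EFin \o f) := measurable_int _ intf.
rewrite -lee_fin -sumEFin.
under eq_bigr => i _.
  rewrite /Rintegral fineK; last first.
    by apply: integrable_fin_num => //; exact: integrableS intf.
  over.
rewrite /Rintegral fineK; last exact: integrable_fin_num.
rewrite -ge0_integral_bigsetU//=.
- by apply: ge0_subset_integral => // x Dx; rewrite lee_fin f0.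
- exact: index_enum_uniq.
- by apply/trivIsetP => i j _ _; exact: dF.
- exact: measurable_funS mf.
- by move=> x /sD Dx; rewrite lee_fin f0.
Qed.

Lemma sum_measure_le n (F : 'I_n -> set T) (D : set T) :
  measurable D -> (mu D < +oo)%E -> (forall i, measurable (F i)) ->
  (forall i, F i `<=` D) -> (forall i j, i != j -> F i `&` F j = set0) ->
  \sum_(i < n) fine (mu (F i)) <= fine (mu D).
Proof.
move=> mD fD mF FD dF.
have := @sum_Rintegral_le n F D (cst 1) mD mF FD dF.
rewrite Rintegral_cst// mul1r.
under eq_bigr do rewrite Rintegral_cst// mul1r.
apply => //; apply: measurable_bounded_integrable => //.
by exists 1; split => // x x1 y _ /=; rewrite normr1 ltW.
Qed.

Lemma bounded_integrable (f : T -> R) (D : set T) (C : R) :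
  measurable D -> (mu D < +oo)%E -> measurable_fun D f ->
  (forall x, D x -> `|f x| <= C) -> mu.-integrable D (EFin \o f).
Proof.
move=> mD fD mf fC; apply: measurable_bounded_integrable => //.
exists C; split; first exact: num_real.
by move=> x Cx y Dy /=; rewrite (le_trans (fC _ Dy))// ltW.
Qed.

Lemma Rintegral_sum n (D : set T) (f : nat -> T -> R) (c : nat -> R) :
  measurable D -> (forall k, mu.-integrable D (EFin \o f k)) ->
  mu.-integrable D (EFin \o (fun x => \sum_(1 <= k < n.+1) c k * f k x)) /\
  Rintegral mu D (fun x => \sum_(1 <= k < n.+1) c k * f k x) =
  \sum_(1 <= k < n.+1) c k * Rintegral mu D (f k).
Proof.
move=> mD intf; elim: n => [|n [IH1 IH2]].
  rewrite [RHS]big_geq//; split.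
    have -> : (EFin \o (fun x => \sum_(1 <= k < 1) c k * f k x)) = cst 0%E.
      by apply/funext => x; rewrite /= big_geq.
    exact: integrable0.
  by under eq_Rintegral do rewrite big_geq//; rewrite Rintegral_cst// mul0r.
have intn : mu.-integrable D (EFin \o (fun x => c n.+1 * f n.+1 x)).
  by have := @integrableZl _ _ _ mu D mD (c n.+1) _ (intf n.+1).
have e : (fun x => \sum_(1 <= k < n.+2) c k * f k x) =
    (fun x => (\sum_(1 <= k < n.+1) c k * f k x) + c n.+1 * f n.+1 x).
  by apply/funext => x; rewrite big_nat_recr.
rewrite e; split; first exact: (integrableD mD IH1 intn).
by rewrite RintegralD// IH2 RintegralZl// [RHS]big_nat_recr.
Qed.

End Packing.

(** * Measurability of the discs and of the kernels *)

Section Measurability.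
Variable R : realType.
Local Notation P := (R * R)%type.

(** On nonnegative reals the inverse is the real power with exponent -1, also at 0, where both are 0
    by convention; so measurability of real powers applies. *)
Lemma measurable_funV_ge0 d (T : measurableType d) (D : set T) (f : T -> R) :
  (forall x, D x -> 0 <= f x) -> measurable_fun D f ->
  measurable_fun D (fun x => (f x)^-1).
Proof.
move=> f0 mf.
apply: (eq_measurable_fun (fun x => f x `^ (-1))).
  by move=> x /set_mem Dx; rewrite powR_inv1// f0.
apply: (@measurableT_comp _ _ _ _ _ _ (fun x : R => x `^ (-1)) _ f) mf.
exact: measurable_powR.
Qed.

Lemma measurable_upper : measurable (@upper R).
Proof.
rewrite (_ : @upper R = snd @^-1` `]0, +oo[%classic); last first.
  by apply/seteqP; split => z; rewrite /upper /= in_itv/= andbT.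
by rewrite -[X in measurable X]setTI; exact: measurable_snd.
Qed.

Lemma measurable_sqmod : measurable_fun setT (@sqmod R).
Proof.
by apply: measurable_funD; apply: measurable_funX;
  [exact: measurable_fst|exact: measurable_snd].
Qed.

Lemma measurable_nrm : measurable_fun setT (@nrm R).
Proof.
apply: measurableT_comp; last exact: measurable_sqmod.
exact: (continuous_measurable_fun (@sqrt_continuous R)).
Qed.

Lemma measurable_odisc (r : R) : measurable (odisc r).
Proof.
rewrite (_ : odisc r = @sqmod R @^-1` `]-oo, r ^+ 2[%classic); last first.
  by apply/seteqP; split => z; rewrite /odisc /= in_itv.
by rewrite -[X in measurable X]setTI; exact: measurable_sqmod.
Qed.

Lemma measurable_cdisc (r : R) : measurable (cdisc r).
Proof.
rewrite (_ : cdisc r = @sqmod R @^-1` `]-oo, r ^+ 2]%classic); last first.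
  by apply/seteqP; split => z; rewrite /cdisc /= in_itv.
by rewrite -[X in measurable X]setTI; exact: measurable_sqmod.
Qed.

Lemma measurable_nrmVX k : measurable_fun setT (fun z : P => nrm z ^- k).
Proof.
apply: measurable_funV_ge0; first by move=> z _; rewrite exprn_ge0// nrm_ge0.
by apply: measurable_funX; exact: measurable_nrm.
Qed.

Lemma measurable_ImVX k :
  measurable_fun setT (fun z : P => complex.Im ((toC z ^+ k)^-1)).
Proof.
have mN : measurable_fun setT (fun z : P => (z.1 ^+ 2 + z.2 ^+ 2)^-1).
  apply: measurable_funV_ge0; first by move=> z _; exact: sqmod_ge0.
  exact: measurable_sqmod.
have mRe1 : measurable_fun setT (fun z : P => complex.Re ((toC z)^-1)).
  apply: (measurable_funM _ mN); exact: measurable_fst.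
have mIm1 : measurable_fun setT (fun z : P => complex.Im ((toC z)^-1)).
  apply: measurable_funN; apply: (measurable_funM _ mN); exact: measurable_snd.
(* Real and imaginary parts must go through the induction together, because each part of a product
   involves both parts of the factors. *)
suff [//] : measurable_fun setT (fun z : P => complex.Im ((toC z ^+ k)^-1)) /\
  measurable_fun setT (fun z : P => complex.Re ((toC z ^+ k)^-1)).
elim: k => [|k [IHI IHR]].
  by split; under eq_fun do rewrite expr0 invr1; exact: measurable_cst.
have E z : (toC z ^+ k.+1)^-1 = (toC z)^-1 * (toC z ^+ k)^-1 :> complex.complex R.
  by rewrite exprS invfM.
have EM (x y : complex.complex R) :
    (complex.Im (x * y) = complex.Re x * complex.Im y + complex.Im x * complex.Re y)
  /\ (complex.Re (x * y) = complex.Re x * complex.Re y - complex.Im x * complex.Im y).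
  by case: x y => [a b] [c e].
split.
  under eq_fun do rewrite E (EM _ _).1.
  by apply: measurable_funD; exact: measurable_funM.
under eq_fun do rewrite E (EM _ _).2.
by apply: measurable_funB; exact: measurable_funM.
Qed.

Lemma measurable_pker2 :
  measurable_fun setT (fun x : P * R => pker x.1 x.2).
Proof.
under eq_fun do rewrite pkerE.
have m1 : measurable_fun setT (fun x : P * R => x.1.1).
  exact: (measurableT_comp measurable_fst measurable_fst).
have m2 : measurable_fun setT (fun x : P * R => x.1.2).
  exact: (measurableT_comp measurable_snd measurable_fst).
apply: measurable_funM => //; apply: measurable_funV_ge0.
  by move=> x _; rewrite addr_ge0// sqr_ge0.
apply: measurable_funD; apply: measurable_funX => //.
by apply: measurable_funB => //; exact: measurable_snd.
Qed.

Lemma measurable_pker (z : P) : measurable_fun setT (pker z).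
Proof.
have := measurableT_comp measurable_pker2 (pair1_measurable z).
by [].
Qed.

Lemma measurable_realpart (B : set P) : measurable B -> measurable (realpart B).
Proof.
move=> mB; rewrite -[X in measurable X]setTI.
exact: (@pair2_measurable _ _ (measurableTypeR R) (measurableTypeR R) 0 measurableT B mB).
Qed.

End Measurability.

(** * Sweeping a single point *)

Section Kernels.
Variable R : realType.
Local Notation P := (R * R)%type.
Local Notation lam := (@lebesgue_measure R).
Implicit Types (z : P) (r : R) (B : set P).

Definition Pois z B : R := pi^-1 * Rintegral lam (realpart B) (pker z).

Definition pint k B : R := Rintegral lam (realpart B) (fun t : R => t ^+ k.-1).

Lemma OmegaE q z B : Omega q z B =
  Pois z B + pi^-1 * \sum_(1 <= k < q.+1) complex.Im ((toC z ^+ k)^-1) * pint k B.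
Proof. by []. Qed.

Lemma realpart_cdisc r : 0 <= r -> realpart (cdisc r) = `[- r, r]%classic.
Proof.
move=> r0; apply/seteqP; split => t; rewrite /realpart /= in_itv/= -ler_norml.
  by move/(in_cdisc _ r0); rewrite /nrm /sqmod /= expr0n/= addr0 sqrtr_sqr.
by move=> h; apply/(in_cdisc _ r0); rewrite /nrm /sqmod /= expr0n/= addr0 sqrtr_sqr.
Qed.

Lemma lam_cdisc r : 0 <= r -> lam (realpart (cdisc r)) = (2 * r)%:E.
Proof.
move=> r0; rewrite realpart_cdisc// lebesgue_measure_itv/= lte_fin.
case: ltP => h; first by rewrite -EFinD opprK -mulr2n mulr_natl.
by congr EFin; lra.
Qed.

Section Bounded.
Variables (r : R) (B : set P).
Hypotheses (r0 : 0 <= r) (mB : measurable B) (Br : B `<=` cdisc r).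

Lemma realpart_bound t : realpart B t -> `|t| <= r.
Proof.
move=> /Br h; have : realpart (cdisc r) t by [].
by rewrite realpart_cdisc//= in_itv/= -ler_norml.
Qed.

Lemma lam_realpart_le : (lam (realpart B) <= (2 * r)%:E)%E.
Proof.
rewrite -lam_cdisc//; apply: le_measure; rewrite ?inE//.
- exact: measurable_realpart.
- by apply: measurable_realpart; exact: measurable_cdisc.
- by move=> t /Br.
Qed.

Lemma lam_realpart_lty : (lam (realpart B) < +oo)%E.
Proof. by rewrite (le_lt_trans lam_realpart_le)// ltry. Qed.

Lemma integrable_pow k : lam.-integrable (realpart B) (EFin \o (fun t : R => t ^+ k)).
Proof.
apply: (@bounded_integrable _ _ _ lam (fun t : R => t ^+ k) _ (r ^+ k)) => //.
- exact: measurable_realpart.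
- exact: lam_realpart_lty.
- by move=> t /realpart_bound h; rewrite normrX lerXn2r// nnegrE.
Qed.

Lemma integrable_pker z : 0 < z.2 -> lam.-integrable (realpart B) (EFin \o pker z).
Proof.
move=> z0; apply: (@bounded_integrable _ _ _ lam (pker z) _ (z.2^-1)) => //.
- exact: measurable_realpart.
- exact: lam_realpart_lty.
- exact: (measurable_funS _ _ (@measurable_pker R z)).
- move=> t _; rewrite ger0_norm ?pker_ge0// pkerE.
  have z2 : 0 < z.2 ^+ 2 by rewrite exprn_gt0.
  rewrite ler_pdivrMr ?ltr_wpDl ?sqr_ge0//.
  by rewrite mulrDr [X in _ + X]mulrA mulVf ?gt_eqF// mul1r lerDr mulr_ge0 ?sqr_ge0// invr_ge0 ltW.
Qed.

Lemma Omega_cker q z : 0 < z.2 ->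
  lam.-integrable (realpart B) (EFin \o cker q z) /\
  Omega q z B = pi^-1 * Rintegral lam (realpart B) (cker q z).
Proof.
move=> z0.
have mr := measurable_realpart mB.
have [iS eS] := @Rintegral_sum _ _ _ lam q (realpart B) (fun k t => t ^+ k.-1)
   (fun k => complex.Im ((toC z ^+ k)^-1)) mr (fun k => integrable_pow k.-1).
have ip := integrable_pker z0.
split; first exact: (@integrableD _ _ _ lam _ mr _ _ ip iS).
by rewrite OmegaE /pint -eS /Pois -mulrDr -RintegralD.
Qed.

Lemma pi_ge1 : 1 <= pi :> R.
Proof. by rewrite (le_trans _ (pi_ge2 R))// ler1n. Qed.

Lemma piV_le1 : pi^-1 <= 1 :> R.
Proof. by rewrite invf_le1 ?pi_ge1// pi_gt0. Qed.

(** The length of the real trace of [B] is kept as a factor instead of being replaced by 2 r: summed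
    over disjoint pieces of the disc, the lengths cost 2 r only once. *)
Lemma Omega_far q z : 0 < z.2 -> 2 * r <= nrm z ->
  `|Omega q z B| <= 2 * r ^+ q / nrm z ^+ q.+1 * fine (lam (realpart B)).
Proof.
move=> z0 rz; have [iC ->] := Omega_cker q z0.
have mr := measurable_realpart mB.
rewrite normrM ger0_norm ?invr_ge0 ?pi_ge0//.
apply: (@le_trans _ _ (`|Rintegral lam (realpart B) (cker q z)|)).
  by rewrite ler_piMl// piV_le1.
apply: (le_trans (@le_normr_Rintegral _ _ _ lam _ _ mr iC)).
rewrite -Rintegral_cst//; apply: le_Rintegral => //.
- exact: (integrable_norm iC).
- apply: (@bounded_integrable _ _ _ lam (cst (2 * r ^+ q / nrm z ^+ q.+1)) _ `|2 * r ^+ q / nrm z ^+ q.+1|) => //.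
  exact: lam_realpart_lty.
- by move=> t /realpart_bound h; apply: cker_far.
Qed.

Lemma abs_pint k : `|pint k B| <= r ^+ k.-1 * fine (lam (realpart B)).
Proof.
have mr := measurable_realpart mB.
have iP := integrable_pow k.-1.
apply: (le_trans (@le_normr_Rintegral _ _ _ lam _ _ mr iP)).
rewrite -Rintegral_cst//; apply: le_Rintegral => //.
- exact: (integrable_norm iP).
- apply: (@bounded_integrable _ _ _ lam (cst (r ^+ k.-1)) _ `|r ^+ k.-1|) => //.
  exact: lam_realpart_lty.
- by move=> t /realpart_bound h; rewrite normrX lerXn2r// nnegrE.
Qed.

Lemma Pois_ge0 z : 0 < z.2 -> 0 <= Pois z B.
Proof.
move=> z0; rewrite mulr_ge0 ?invr_ge0 ?pi_ge0//.
by apply: Rintegral_ge0 => t _; exact: pker_ge0.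
Qed.

Lemma measurable_Pois : measurable_fun (@upper R) (fun z => Pois z B).
Proof.
have mr := measurable_realpart mB.
have mu := @measurable_upper R.
(* The absolute value makes the integrand nonnegative on the whole plane, as Tonelli's theorem
   requires, and changes nothing on the upper half plane. The indicator replaces the domain of
   integration. *)
pose g (x : P * R) : \bar R := (`|pker x.1 x.2| * \1_(realpart B) x.2)%:E.
have mg : measurable_fun setT g.
  apply/measurable_EFinP; apply: measurable_funM.
    by apply: measurableT_comp => //; exact: measurable_pker2.
  by apply: measurableT_comp => //; exact: measurable_indic.
have g0 x : (0 <= g x)%E by rewrite lee_fin mulr_ge0.
have mF := @measurable_fun_fubini_tonelli_F _ _ _ _ _ lam g mg g0.
apply: (eq_measurable_fun (fun z => pi^-1 * fine (fubini_F lam g z))).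
  move=> z /set_mem z0; congr (_ * fine _).
  rewrite integral_mkcond /fubini_F; apply: eq_integral => t _.
  rewrite /g patchE /= indicE; case: ifP => h; last by rewrite mulr0.
  by rewrite mulr1 ger0_norm ?pker_ge0.
apply: measurable_funM => //.
apply: (measurable_funS measurableT) => //.
exact: (@measurableT_comp _ _ _ _ _ _ fine setT (fubini_F lam g) (fine_measurable measurableT) mF).
Qed.

Lemma measurable_Omega q : measurable_fun (@upper R) (fun z => Omega q z B).
Proof.
under eq_fun do rewrite OmegaE.
apply: measurable_funD; first exact: measurable_Pois.
apply: measurable_funM => //; apply: measurable_sum => k.
apply: measurable_funM => //.
apply: (measurable_funS measurableT) => //; exact: measurable_ImVX.
Qed.

End Bounded.

(** An antiderivative of the kernel is arctan((t - Re z) / Im z), whose values stay between -pi/2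
    and pi/2. *)
Lemma pker_mass z r : 0 < z.2 -> 0 < r ->
  Rintegral lam (realpart (cdisc r)) (pker z) <= pi.
Proof.
move=> z0 r0; rewrite realpart_cdisc ?ltW//.
have rr : - r < r by lra.
pose F (t : R) := atan ((t - z.1) / z.2).
have dF (t : R) : is_derive t 1 F (pker z t).
  have -> : pker z t = (1 + ((t - z.1) / z.2) ^+ 2)^-1 * z.2^-1.
    rewrite pkerE; have h1 : 0 < (t - z.1) ^+ 2 + z.2 ^+ 2.
      by rewrite ltr_wpDl ?sqr_ge0// exprn_gt0.
    have h2 : 0 < 1 + ((t - z.1) / z.2) ^+ 2 by rewrite ltr_pwDl// sqr_ge0.
    by field; rewrite !gt_eqF// addrC.
  refine (@is_derive1_comp R (@atan R) (fun t : R => (t - z.1) / z.2) t _ _ _ _).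
  by apply: is_derive_eq; rewrite /= ?subr0 ?scaler0 ?add0r ?addr0 /GRing.scale /= ?mulr1.
have cF (t : R) : {for t, continuous F}.
  by apply/differentiable_continuous/derivable1_diffP; case: (dF t).
have cp : continuous (pker z).
  move=> t; rewrite /continuous_at.
  have -> : pker z = (fun t => z.2 / ((t - z.1) ^+ 2 + z.2 ^+ 2)).
    by apply/funext => u; rewrite pkerE.
  apply: cvgM; first exact: cvg_cst.
  apply: cvgV; first by rewrite gt_eqF// ltr_wpDl ?sqr_ge0// exprn_gt0.
  apply: cvgD; last exact: cvg_cst.
  rewrite expr2; under eq_fun do rewrite expr2.
  by apply: cvgM; apply: cvgB => //; exact: cvg_cst.
rewrite /Rintegral (@continuous_FTC2 _ (pker z) F)//=.
- rewrite /F.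
  have := atan_ltpi2 ((r - z.1) / z.2); have := atan_gtNpi2 ((- r - z.1) / z.2).
  lra.
- exact: continuous_in_subspaceT.
- split.
  + by move=> x _; case: (dF x).
  + by apply: cvg_at_right_filter; exact: cF.
  + by apply: cvg_at_left_filter; exact: cF.
- by move=> x _; rewrite derive1E; case: (dF x).
Qed.

(** Disjoint pieces share the total Poisson mass of [-r, r], so the bound depends neither on [n] nor
    on [z]. *)
Lemma sum_Pois_le1 z r n (F : 'I_n -> set P) : 0 < z.2 -> 0 < r ->
  (forall i, measurable (F i)) -> (forall i, F i `<=` cdisc r) ->
  (forall i j, i != j -> F i `&` F j = set0) ->
  \sum_(i < n) Pois z (F i) <= 1.
Proof.
move=> z0 r0 mF FD dF; rewrite -mulr_sumr mulrC ler_pdivrMr ?pi_gt0// mul1r.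
apply: le_trans (pker_mass z0 r0).
have mc := @measurable_cdisc R r.
apply: sum_Rintegral_le.
- exact: measurable_realpart.
- by move=> i; exact: measurable_realpart.
- by move=> i t /FD.
- by move=> i j ij; rewrite -[RHS]/(realpart set0) -(dF _ _ ij).
- by apply: (@integrable_pker r) => //; exact: ltW.
- by move=> t _; exact: pker_ge0.
Qed.

Lemma sum_lam_le r n (F : 'I_n -> set P) : 0 <= r ->
  (forall i, measurable (F i)) -> (forall i, F i `<=` cdisc r) ->
  (forall i j, i != j -> F i `&` F j = set0) ->
  \sum_(i < n) fine (lam (realpart (F i))) <= 2 * r.
Proof.
move=> r0 mF FD dF; rewrite -[2 * r]/(fine (2 * r)%:E) -lam_cdisc//.
apply: sum_measure_le.
- by apply: measurable_realpart; exact: measurable_cdisc.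
- exact: (lam_realpart_lty r0 (measurable_cdisc r)).
- by move=> i; exact: measurable_realpart.
- by move=> i t /FD.
- by move=> i j ij; rewrite -[RHS]/(realpart set0) -(dF _ _ ij).
Qed.

End Kernels.

(** * From the charge to its positive and negative parts *)

Section Charge.
Variable R : realType.
Local Notation P := (R * R)%type.
Variables mup mun : {measure set P -> \bar R}.
Hypotheses (lfp : locfin mup) (lfn : locfin mun) (ms : mutsing mup mun).

Lemma tvar_ge (m : set P -> R) (A F : set P) : measurable F -> F `<=` A ->
  (`|m F|%:E <= tvar m A)%E.
Proof.
move=> mF FA; apply: ereal_sup_ubound; exists 1%N, (fun=> F); split => //.
  by move=> i j; rewrite !ord1 eqxx.
by rewrite big_ord1.
Qed.

(** The set [A] separating the two measures cuts [D] into a piece seen only by [mun] and a piece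
    seen only by [mup]. Either piece alone is an admissible test family for the variation. *)
Lemma measure_le_tvar (D : set P) : measurable D ->
  (mup D < +oo)%E -> (mun D < +oo)%E ->
  (mup D <= tvar (chg mup mun) D)%E /\ (mun D <= tvar (chg mup mun) D)%E.
Proof.
move=> mD fp fn; have [A [mA pA nA]] := ms.
have mDA : measurable (D `&` A) by exact: measurableI.
have mDC : measurable (D `&` ~` A) by apply: measurableI => //; exact: measurableC.
have z1 : mup (D `&` A) = 0%E by apply: subset_measure0 pA => //; exact: subIsetr.
have z2 : mun (D `&` ~` A) = 0%E.
  exact: (subset_measure0 mDC (measurableC mA) (@subIsetr _ _ _) nA).
have DE : D = (D `&` A) `|` (D `&` ~` A) by rewrite -setIUr setUv setIT.
have dA : (D `&` A) `&` (D `&` ~` A) = set0 by rewrite setIACA setICr setI0.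
have ep : mup D = mup (D `&` ~` A).
  by have := measureU mup mDA mDC dA; rewrite -DE [X in (X + _)%E]z1 add0e.
have en : mun D = mun (D `&` A).
  by have := measureU mun mDA mDC dA; rewrite -DE [X in (_ + X)%E]z2 adde0.
split.
  apply: le_trans (tvar_ge _ mDC (@subIsetl _ _ _)).
  by rewrite /chg z2 subr0 -ep ger0_norm ?fine_ge0// fineK// ge0_fin_numE.
apply: le_trans (tvar_ge _ mDA (@subIsetl _ _ _)).
by rewrite /chg z1 sub0r normrN -en ger0_norm ?fine_ge0// fineK// ge0_fin_numE.
Qed.

(** A countable basis of the plane: [x.1] bounds the real part and [x.2] the imaginary part. *)
Definition rat_rect (x : (rat * rat) * (rat * rat)) : set P :=
  [set z | [/\ ratr x.1.1 < z.1, z.1 < ratr x.1.2, ratr x.2.1 < z.2 & z.2 < ratr x.2.2]].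

Lemma rat_rect_basis (w : P) (e : R) : 0 < e ->
  exists2 x, rat_rect x w & rat_rect x `<=` oball w e.
Proof.
move=> e0.
have near (a : R) : exists b : rat * rat, ratr b.1 < a /\ a < ratr b.2 /\
    a - e / 2 < ratr b.1 /\ ratr b.2 < a + e / 2.
  have h1 : a - e / 2 < a by lra.
  have h2 : a < a + e / 2 by lra.
  have [b1 /[!in_itv]/= /andP[? ?]] := rat_in_itvoo h1.
  have [b2 /[!in_itv]/= /andP[? ?]] := rat_in_itvoo h2.
  by exists (b1, b2).
have [b [b1 [b2 [b3 b4]]]] := near w.1.
have [c [c1 [c2 [c3 c4]]]] := near w.2.
exists (b, c); first by split.
move=> z [/= z1 z2 z3 z4]; rewrite /oball /=.
have sq (u : R) : - (e / 2) < u -> u < e / 2 -> u ^+ 2 < (e / 2) ^+ 2.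
  by move=> u1 u2; rewrite -real_normK ?num_real// ltrXn2r// ?nnegrE ?ltr_norml ?u1 ?u2//;
    rewrite divr_ge0// ltW.
have := sq (z.1 - w.1); have := sq (z.2 - w.2).
have e2 : 0 < e ^+ 2 by rewrite exprn_gt0.
have -> : (e / 2) ^+ 2 = e ^+ 2 / 4 by field.
move=> h1 h2; have {}h1 := h1 ltac:(lra) ltac:(lra).
have {}h2 := h2 ltac:(lra) ltac:(lra).
lra.
Qed.

(** A Lindelöf argument: every point of [U] lies in a negligible rational rectangle, and there are
    only countably many of these. *)
Lemma null_of_local (mu : {measure set P -> \bar R}) (U : set P) : measurable U ->
  (forall w, U w -> exists2 e, 0 < e & mu.-negligible (oball w e)) -> mu U = 0%E.
Proof.
move=> mU h.
(* [G] enumerates the negligible rational rectangles; invalid codes and the other rectangles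
   contribute the empty set. *)
pose G n : set P := if unpickle n is Some x then
  if pselect (mu.-negligible (rat_rect x)) then rat_rect x else set0 else set0.
apply: measure_negligible => //.
apply: (@negligibleS _ _ _ _ (\bigcup_n G n)).
  move=> w /h[e e0 he]; have [x xw xe] := rat_rect_basis w e0.
  exists (pickle x); first exact: I.
  rewrite /G pickleK; case: pselect => [hx|nx]; first exact: xw.
  by exfalso; apply: nx; exact: negligibleS he.
apply: negligible_bigcup => n; rewrite /G; case: unpickle => [x|].
  by case: pselect => [np|nn]; [exact: np|exact: negligible_set0].
exact: negligible_set0.
Qed.

Lemma cdisc_le (r s : R) : 0 <= r -> r <= s -> cdisc r `<=` cdisc s.
Proof.
move=> r0 rs z /(in_cdisc z r0) h; apply/in_cdisc; first exact: le_trans rs.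
exact: le_trans rs.
Qed.

Lemma odisc_cdisc (r : R) : 0 <= r -> odisc r `<=` cdisc r.
Proof. by move=> r0 z; rewrite /odisc /cdisc /= => /ltW. Qed.

Lemma measurable_oball (w : P) e : measurable (oball w e).
Proof.
rewrite (_ : oball w e = (fun z : P => (z.1 - w.1) ^+ 2 + (z.2 - w.2) ^+ 2)
   @^-1` `]-oo, e ^+ 2[%classic); last first.
  by apply/seteqP; split => z; rewrite /oball /= in_itv.
rewrite -[X in measurable X]setTI.
have m : measurable_fun setT (fun z : P => (z.1 - w.1) ^+ 2 + (z.2 - w.2) ^+ 2).
  by apply: measurable_funD; apply: measurable_funX; apply: measurable_funB.
exact: m.
Qed.

Lemma bounded_oball (w : P) e : 0 <= e -> oball w e `<=` cdisc (nrm w + e).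
Proof.
move=> e0 z; rewrite /oball /= => h.
apply/in_cdisc; first by rewrite addr_ge0// nrm_ge0.
have hd : nrm (z - w) <= e.
  have /(in_odisc _ e0)/ltW // : odisc e (z - w) by rewrite /odisc /sqmod.
have -> : z = w + (z - w) by rewrite addrC subrK.
rewrite !nrmE.
have -> : toC (w + (z - w)) = toC w + toC (z - w) by case: (w) (z - w) => [? ?] [? ?].
by apply: le_trans (le_normcD _ _) _; rewrite lerD2l -nrmE.
Qed.

(** A point off the support has a ball of zero variation, which is null for both Jordan parts; local
    nullness then spreads to the whole disc. *)
Lemma null_odisc (r0 : R) : 0 < r0 -> odisc r0 `&` supp mup mun = set0 ->
  mup (odisc r0) = 0%E /\ mun (odisc r0) = 0%E.
Proof.
move=> r00 h.
have loc w : odisc r0 w -> exists2 e, 0 < e &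
    mup (oball w e) = 0%E /\ mun (oball w e) = 0%E.
  move=> ow; have : ~ supp mup mun w.
    by move=> sw; have : set0 w by rewrite -h.
  move=> /existsNP[e /not_implyP[e0 /negP/negbNE/eqP t0]].
  exists e => //.
  have mo := measurable_oball w e.
  have mc := @measurable_cdisc R (nrm w + e).
  have sub := @bounded_oball w e (ltW e0).
  have fp : (mup (oball w e) < +oo)%E.
    by apply: le_lt_trans (lfp (nrm w + e)); apply: le_measure; rewrite ?inE.
  have fn : (mun (oball w e) < +oo)%E.
    by apply: le_lt_trans (lfn (nrm w + e)); apply: le_measure; rewrite ?inE.
  have := measure_le_tvar mo fp fn; rewrite t0 => -[h1 h2].
  by split; apply/eqP; rewrite -measure_le0.
have mo := @measurable_odisc R r0.
split; apply: null_of_local => // w /loc[e e0 [h1 h2]]; exists e => //;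
  by apply/negligibleP => //; exact: measurable_oball.
Qed.

(** Finite type controls only large radii. Below [r0] the mass vanishes, and on the remaining
    bounded range of radii s^p is at least r0^p, so a constant multiple of s^p dominates the finite
    mass there. This gives one constant for all radii and both parts. *)
Lemma finite_type_growth (p r0 : R) : 0 <= p -> 0 < r0 ->
  finite_type (chg mup mun) p -> odisc r0 `&` supp mup mun = set0 ->
  exists2 A, 0 <= A & forall s, 0 <= s ->
    (mup (cdisc s) <= (A * s `^ p)%:E)%E /\ (mun (cdisc s) <= (A * s `^ p)%:E)%E.
Proof.
move=> p0 r00 [C hC] h0.
have [np nn] := null_odisc r00 h0.
have [M [_ hM]] := hC.
pose M1 := Num.max (M + 1) r0.
have M1r : r0 <= M1 by rewrite le_max lexx orbT.
have MM1 : M < M1 by rewrite lt_max ltrDl ltr01.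
have M10 : 0 <= M1 by rewrite (le_trans _ M1r)// ltW.
pose A0 := (fine (mup (cdisc M1)) + fine (mun (cdisc M1))) / r0 `^ p.
have A00 : 0 <= A0 by rewrite divr_ge0 ?powR_ge0// addr_ge0// fine_ge0.
exists (Num.max C A0); first by rewrite le_max A00 orbT.
move=> s s0.
have mc t := @measurable_cdisc R t.
have [sr|rs] := ltP s r0.
  have sub : cdisc s `<=` odisc r0.
    by move=> z /(in_cdisc _ s0) h; apply/in_odisc; [exact: ltW|exact: le_lt_trans sr].
  have C0 : (0 <= (Num.max C A0 * s `^ p)%:E)%E.
    by rewrite lee_fin mulr_ge0 ?powR_ge0// le_max A00 orbT.
  have mo := @measurable_odisc R r0.
  by rewrite (subset_measure0 (mc s) mo sub np) (subset_measure0 (mc s) mo sub nn).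
have [sM|Ms] := ltP M1 s.
  have hs := hM s (lt_trans MM1 sM).
  have hle : ((C * s `^ p)%:E <= (Num.max C A0 * s `^ p)%:E)%E.
    by rewrite lee_fin ler_wpM2r ?powR_ge0// le_max lexx.
  have [h1 h2] := measure_le_tvar (mc s) (lfp s) (lfn s).
  by split; apply: le_trans hle; apply: le_trans hs.
have sub := cdisc_le s0 Ms.
have key (mu nu : {measure set P -> \bar R}) : locfin mu -> 
   fine (mu (cdisc M1)) + fine (nu (cdisc M1)) =
   fine (mup (cdisc M1)) + fine (mun (cdisc M1)) ->
  (mu (cdisc s) <= (Num.max C A0 * s `^ p)%:E)%E.
  move=> lmu e; apply: (@le_trans _ _ (mu (cdisc M1))).
    by apply: le_measure; rewrite ?inE.
  rewrite -(@fineK _ (mu (cdisc M1))) ?ge0_fin_numE// lee_fin.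
  apply: (@le_trans _ _ (A0 * s `^ p)); last first.
    by rewrite ler_wpM2r ?powR_ge0// le_max lexx orbT.
  have rp : 0 < r0 `^ p by rewrite powR_gt0.
  apply: (@le_trans _ _ (A0 * r0 `^ p)); last first.
    by rewrite ler_wpM2l// ge0_ler_powR// ?nnegrE// ltW.
  by rewrite /A0 divfK ?gt_eqF// -e lerDl fine_ge0.
by split; [exact: (key mup mun)|apply: (key mun mup) => //; rewrite addrC].
Qed.

End Charge.

(** * Radial moments *)

Section Annuli.
Variable R : realType.
Local Notation P := (R * R)%type.

Definition ann (a b : R) : set P := odisc b `\` odisc a.

Lemma in_ann a b (z : P) : 0 <= a -> 0 <= b -> ann a b z <-> a <= nrm z < b.
Proof.
move=> a0 b0; split.
  move=> [/(in_odisc z b0) -> h]; rewrite andbT leNgt; apply/negP => h2.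
  by apply: h; apply/in_odisc.
move=> /andP[h1 h2]; split; first exact/in_odisc.
by move=> /(in_odisc z a0); rewrite ltNge h1.
Qed.

Lemma measurable_ann a b : measurable (ann a b).
Proof. by apply: measurableD; exact: measurable_odisc. Qed.

Lemma measurable_EnrmVX (D : set P) k :
  measurable_fun D (fun z : P => (nrm z ^- k)%:E).
Proof.
apply/measurable_EFinP; apply: (measurable_funS measurableT) => //.
exact: measurable_nrmVX.
Qed.

Lemma EnrmVX_ge0 k (z : P) : (0 <= (nrm z ^- k)%:E)%E.
Proof. by rewrite lee_fin invr_ge0 exprn_ge0// nrm_ge0. Qed.

Lemma geometric_le (q : R) n : 0 <= q -> q < 1 -> \sum_(i < n) q ^+ i <= (1 - q)^-1.
Proof.
move=> q0 q1; have h : 0 < 1 - q by lra.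
rewrite -[leLHS](mulKf (lt0r_neq0 h)) ler_piMr ?invr_ge0 ?(ltW h)//.
have := subrX1 q n; move=> e.
have -> : (1 - q) * \sum_(i < n) q ^+ i = 1 - q ^+ n.
  by apply: oppr_inj; rewrite opprB e -mulNr opprB.
by rewrite gerBl exprn_ge0.
Qed.

Lemma powR_dyadic (a x : R) j : 0 <= a ->
  (2 ^+ j * a) `^ x = (2 `^ x) ^+ j * a `^ x.
Proof.
move=> a0; rewrite powRM// ?exprn_ge0//.
by rewrite -(@powR_mulrn _ 2)// -(@powR_mulrn _ (2 `^ x)) ?powR_ge0// powRAC.
Qed.

Lemma powRBn (a x : R) k : 0 < a -> a `^ (x - k%:R) = a `^ x / a ^+ k.
Proof.
move=> a0; rewrite powRB; first by rewrite powR_mulrn ?ltW.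
by rewrite (gt_eqF a0) /= implybT.
Qed.

(** * Dyadic estimates for a positive measure of power growth *)

Section Growth.
Variables (mu : {measure set P -> \bar R}) (A p : R).
Hypotheses (A0 : 0 <= A)
  (hA : forall s, 0 <= s -> (mu (cdisc s) <= (A * s `^ p)%:E)%E).

(** The shell a <= |z| < 2 a lies in the disc of radius 2 a and so has mass at most A (2 a)^p, which
    is [gK] times a^p. *)
Definition gK : R := A * 2 `^ p.

Lemma gK_ge0 : 0 <= gK. Proof. by rewrite mulr_ge0 ?powR_ge0. Qed.

Lemma integral_le_cst (D : set P) (f : P -> R) (c : R) : measurable D -> 0 <= c ->
  measurable_fun D f -> (forall z, D z -> 0 <= f z <= c) ->
  (\int[mu]_(z in D) (f z)%:E <= c%:E * mu D)%E.
Proof.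
move=> mD c0 mf fc; rewrite -integral_cst//; apply: ge0_le_integral => //.
- by move=> z /fc /andP[h _]; rewrite lee_fin.
- exact/measurable_EFinP.
- by move=> z /fc /andP[_ h]; rewrite lee_fin.
Qed.

Lemma shell_le a k : 0 < a ->
  (\int[mu]_(z in ann a (2 * a)) (nrm z ^- k)%:E <= (gK * a `^ (p - k%:R))%:E)%E.
Proof.
move=> a0; have a2 : 0 <= 2 * a by lra.
have ak : 0 <= a ^- k by rewrite invr_ge0 exprn_ge0// ltW.
apply: (@le_trans _ _ ((a ^- k)%:E * mu (ann a (2 * a)))%E).
  apply: integral_le_cst => //; first exact: measurable_ann.
    by apply: (measurable_funS measurableT) => //; exact: measurable_nrmVX.
  move=> z /(in_ann z (ltW a0) a2)/andP[h _].
  rewrite invr_ge0 exprn_ge0 ?nrm_ge0//= lef_pV2 ?posrE ?exprn_gt0 ?(lt_le_trans a0)//.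
  by rewrite lerXn2r ?nnegrE// ?nrm_ge0// ltW.
apply: (@le_trans _ _ ((a ^- k)%:E * mu (cdisc (2 * a)))%E).
  apply: lee_wpmul2l => //; apply: le_measure; rewrite ?inE.
  - exact: measurable_ann.
  - exact: measurable_cdisc.
  - by move=> z [/(odisc_cdisc a2)].
apply: (@le_trans _ _ ((a ^- k)%:E * (A * (2 * a) `^ p)%:E)%E).
  by apply: lee_wpmul2l => //; exact: hA.
rewrite -EFinM lee_fin powRBn// powRM ?(ltW a0)// /gK.
by rewrite le_eqVlt; apply/orP; left; apply/eqP; ring.
Qed.

(** Consecutive shell bounds have ratio 2^(p - k). The three cases where this ratio is above, below
    or equal to 1 become [near_le], [far_le] and [log_le]. *)
Lemma dyadic_le a k n : 0 < a ->
  (\int[mu]_(z in ann a (2 ^+ n * a)) (nrm z ^- k)%:E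
   <= (gK * a `^ (p - k%:R) * \sum_(j < n) (2 `^ (p - k%:R)) ^+ j)%:E)%E.
Proof.
move=> a0; elim: n => [|n IHn].
  rewrite expr0 mul1r /ann setDv integral_set0 lee_fin big_ord0 mulr0//.
have b0 : 0 < 2 ^+ n * a by rewrite mulr_gt0// exprn_gt0.
have c0 : 0 < 2 ^+ n.+1 * a by rewrite mulr_gt0// exprn_gt0.
have ab : a <= 2 ^+ n * a by rewrite ler_peMl ?(ltW a0)// exprn_ege1// ler1n.
have bc : 2 ^+ n * a <= 2 ^+ n.+1 * a.
  by rewrite ler_wpM2r ?(ltW a0)// exprS ler_peMl ?exprn_ge0// ler1n.
have -> : ann a (2 ^+ n.+1 * a) = ann a (2 ^+ n * a) `|` ann (2 ^+ n * a) (2 ^+ n.+1 * a).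
  apply/seteqP; split => z.
    move=> /(in_ann z (ltW a0) (ltW c0))/andP[h1 h2].
    case: (ltP (nrm z) (2 ^+ n * a)) => h; [left|right]; apply/in_ann; rewrite ?(ltW a0) ?(ltW b0) ?(ltW c0)//.
    - by rewrite h1.
    - by rewrite h.
  move=> [/(in_ann z (ltW a0) (ltW b0))/andP[h1 h2]|/(in_ann z (ltW b0) (ltW c0))/andP[h1 h2]];
    apply/in_ann; rewrite ?(ltW a0) ?(ltW b0) ?(ltW c0)//.
    by rewrite h1 (lt_le_trans h2).
  by rewrite h2 (le_trans ab h1).
rewrite ge0_integral_setU//=; try exact: measurable_ann.
- rewrite big_ord_recr /= mulrDr EFinD; apply: leeD; first exact: IHn.
  rewrite exprS -mulrA; apply: (le_trans (shell_le k b0)).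
  by rewrite powR_dyadic ?(ltW a0)// lee_fin -mulrA [X in gK * X]mulrC.
- exact: measurable_EnrmVX.
- by move=> z _; exact: EnrmVX_ge0.
- rewrite disj_set2E; apply/eqP/seteqP; split => // z [].
  move=> /(in_ann z (ltW a0) (ltW b0))/andP[_ h1] /(in_ann z (ltW b0) (ltW c0))/andP[h2 _].
  by move: h1; rewrite ltNge h2.
Qed.

(** Here the outermost shell dominates: counted inwards from radius [r], the shell bounds form a
    geometric series with ratio 2^(k - p) < 1. *)
Lemma near_le r0 k : 0 < r0 -> 0 < p - k%:R ->
  exists2 C, 0 <= C & forall r, 0 < r ->
    (\int[mu]_(z in ann r0 r) (nrm z ^- k)%:E <= (C * r `^ (p - k%:R))%:E)%E.
Proof.
have := dyadic_le; have := gK_ge0; move: gK => K K_ge0 hd.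
move=> r00; set x := p - k%:R => x0.
pose q : R := (2 `^ x)^-1.
have t1 : 1 < 2 `^ x.
  by rewrite -[ltLHS](powRr0 2) /powR; case: ifP; rewrite ?pnatr_eq0// => _;
     rewrite ltr_expR mul0r mulr_gt0// ln_gt0// ltr1n.
have t0 : 0 < 2 `^ x by rewrite (lt_trans _ t1).
have q0 : 0 <= q by rewrite invr_ge0 ltW.
have q1 : q < 1 by rewrite invf_lt1.
exists (K * (q / (1 - q))).
  by rewrite mulr_ge0 ?K_ge0// divr_ge0// subr_ge0 ltW.
move=> r r_0; pose n := (Num.truncn (r / r0)).+1.
have hn : r <= 2 ^+ n * r0.
  rewrite -ler_pdivrMr// (le_trans (ltW (truncnS_gt _)))//.
  by rewrite -/n -natrX ler_nat ltnW// ltn_expl.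
have p2 : 0 < 2 ^+ n :> R by rewrite exprn_gt0.
(* Starting at r / 2^n, which is at most [r0], makes the last shell end exactly at [r]. *)
pose a := r / 2 ^+ n.
have a0 : 0 < a by rewrite divr_gt0.
have ar : a <= r0 by rewrite ler_pdivrMr// mulrC.
have er : 2 ^+ n * a = r by rewrite mulrC divfK// gt_eqF.
apply: (@le_trans _ _ (\int[mu]_(z in ann a r) (nrm z ^- k)%:E)%E).
  apply: ge0_subset_integral; [exact: measurable_ann|exact: measurable_ann|exact: measurable_EnrmVX| |].
    by move=> z _; exact: EnrmVX_ge0.
  move=> z /(in_ann z (ltW r00) (ltW r_0))/andP[h1 h2].
  by apply/in_ann; rewrite ?(ltW a0) ?(ltW r_0)// h2 (le_trans ar).
rewrite -{1}er; apply: (le_trans (hd _ k n a0)).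
rewrite lee_fin -/x -!mulrA ler_wpM2l ?K_ge0//.
have -> : a `^ x = q ^+ n * r `^ x.
  by rewrite -er powR_dyadic ?(ltW a0)// mulrA exprVn mulVf ?mul1r// gt_eqF// exprn_gt0.
rewrite mulrAC [leRHS]mulrA ler_wpM2r ?powR_ge0//.
(* Reversing the order of summation turns the growing series into a decaying one. *)
have -> : q ^+ n * (\sum_(j < n) (2 `^ x) ^+ j) = q * \sum_(j < n) q ^+ j.
  rewrite !mulr_sumr (reindex_inj rev_ord_inj) /=; apply: eq_bigr => j _.
  have jn := ltn_ord j.
  have -> : q ^+ n = q * q ^+ j * q ^+ (n - j.+1) by rewrite -exprS -exprD subnKC.
  by rewrite -mulrA [q ^+ (n - _)]exprVn mulVf ?mulr1// gt_eqF// exprn_gt0.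
by rewrite ler_wpM2l// geometric_le.
Qed.

(** The annuli from [a] to 2^n a exhaust the complement of the disc, the convergent geometric series
    bounds all of them at once, and monotone convergence passes to the limit. *)
Lemma far_le a k : 0 < a -> p - k%:R < 0 ->
  (\int[mu]_(z in ~` odisc a) (nrm z ^- k)%:E
    <= (gK * (1 - 2 `^ (p - k%:R))^-1 * a `^ (p - k%:R))%:E)%E.
Proof.
have := dyadic_le; have := gK_ge0; move: gK => K K_ge0 hd.
move=> a0; set x := p - k%:R => x0.
have t1 : 2 `^ x < 1.
  by rewrite -[ltRHS](powRr0 2) /powR; case: ifP; rewrite ?pnatr_eq0// => _;
     rewrite ltr_expR mul0r nmulr_rlt0// ln_gt0// ltr1n.
pose F n := ann a (2 ^+ n * a).
have p2 n : 0 <= 2 ^+ n * a by rewrite mulr_ge0 ?exprn_ge0// ltW.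
have FU : \bigcup_n F n = ~` odisc a.
  apply/seteqP; split => z; first by move=> [n _ []].
  move=> h; pose n := (Num.truncn (nrm z / a)).+1.
  exists n => //; split => //; apply/(in_odisc _ (p2 n)).
  rewrite -ltr_pdivrMr// (lt_le_trans (truncnS_gt _))//.
  by rewrite -/n -natrX ler_nat ltnW// ltn_expl.
rewrite -FU; apply: cvge_le (ge0_nondecreasing_set_cvg_integral _ _ _ _).
- apply: nearW => n; apply: (le_trans (hd _ k n a0)).
  rewrite lee_fin -/x mulrAC ler_wpM2r ?powR_ge0// ler_wpM2l ?K_ge0//.
  by rewrite geometric_le// powR_ge0.
- apply/nondecreasing_seqP => n; apply/subsetPset => z.
  move=> /(in_ann z (ltW a0) (p2 n))/andP[h1 h2].
  apply/in_ann; rewrite ?(ltW a0)// h1 (lt_le_trans h2)//.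
  by rewrite ler_wpM2r ?(ltW a0)// exprS ler_peMl ?exprn_ge0// ler1n.
- by move=> n; exact: measurable_ann.
- by move=> n; exact: measurable_EnrmVX.
- by move=> n z _; exact: EnrmVX_ge0.
Qed.

(** All shells have the same bound, so the estimate is the number of shells needed to reach radius
    [r], which is of order log r. *)
Lemma log_le r0 k : 0 < r0 -> p - k%:R = 0 ->
  exists2 C, 0 <= C & forall r, expR 1 <= r ->
    (\int[mu]_(z in ann r0 r) (nrm z ^- k)%:E <= (C * ln r)%:E)%E.
Proof.
have := dyadic_le; have := gK_ge0; move: gK => K K_ge0 hd.
move=> r00 pk.
have l2 : 0 < ln (2 : R) by rewrite ln_gt0// ltr1n.
(* As ln r >= 1, the number ln r - ln r0 is at most (1 + |ln r0|) ln r; the final 1 absorbs the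
   rounding up to an integer. *)
pose D := (1 + `|ln r0|) / ln 2 + 1.
have D0 : 0 <= D by rewrite addr_ge0// divr_ge0 ?addr_ge0// ltW.
exists (K * D); first by rewrite mulr_ge0 ?K_ge0.
move=> r re; have r_0 : 0 < r by rewrite (lt_le_trans _ re)// expR_gt0.
have lr : 1 <= ln r by rewrite -[leLHS](expRK (1 : R)) ler_ln ?posrE ?expR_gt0.
pose y := ln (r / r0) / ln 2.
pose n := (Num.truncn y).+1.
have hn : r <= 2 ^+ n * r0.
  rewrite -ler_pdivrMr// -[leLHS]lnK ?posrE ?divr_gt0//.
  rewrite -[leRHS]lnK ?posrE ?exprn_gt0// ler_expR lnXn// -[leRHS]mulr_natl.
  by rewrite -ler_pdivrMr// ltW// truncnS_gt.
apply: (@le_trans _ _ (\int[mu]_(z in ann r0 (2 ^+ n * r0)) (nrm z ^- k)%:E)%E).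
  apply: ge0_subset_integral; [exact: measurable_ann|exact: measurable_ann|exact: measurable_EnrmVX| |].
    by move=> z _; exact: EnrmVX_ge0.
  move=> z /(in_ann z (ltW r00) (ltW r_0))/andP[h1 h2].
  by apply/in_ann; rewrite ?(ltW r00) ?(le_trans (ltW r_0))// h1 (lt_le_trans h2).
apply: (le_trans (hd _ k n r00)).
rewrite lee_fin pk !powRr0 mulr1 -mulrA ler_wpM2l ?K_ge0//.
under eq_bigr do rewrite expr1n.
rewrite sumr_const card_ord /n -addn1 natrD /D mulrDl mul1r lerD//.
have yD : y <= (1 + `|ln r0|) / ln 2 * ln r.
  rewrite mulrAC /y ler_pM2r ?invr_gt0// lnM ?posrE ?invr_gt0// lnV ?posrE//.
  rewrite mulrDl mul1r lerD2l (le_trans (ler_norm _))// normrN ler_peMr//.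
(* For r < r0 the number [y] is negative and its truncation is 0 by default, hence the maximum. *)
apply: le_trans (_ : Num.max y 0 <= _).
  have [y0|y0] := leP 0 y.
    by rewrite truncn_le.
  have -> : Num.truncn y = 0%N; last by [].
  by apply/eqP; rewrite -leqn0 truncn_le_nat; lra.
rewrite ge_max yD mulr_ge0 ?divr_ge0 ?addr_ge0 ?(ltW l2)//.
by rewrite (le_trans _ lr).
Qed.

End Growth.
End Annuli.

(** * Sweeping a positive measure *)

Section Domination.
Context d (T : measurableType d) (R : realType) (mu : {measure set T -> \bar R}).

Lemma dominated_integral (D : set T) (f g : T -> R) (c : R) : measurable D ->
  measurable_fun D f -> measurable_fun D g -> (forall x, D x -> `|f x| <= g x) ->
  (\int[mu]_(x in D) (g x)%:E <= c%:E)%E ->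
  mu.-integrable D (EFin \o f) /\ `|Rintegral mu D f| <= c.
Proof.
move=> mD mf mg fg gc.
have g0 x : D x -> 0 <= g x by move=> /fg; exact: le_trans.
have fc : (\int[mu]_(x in D) `|(f x)%:E| <= c%:E)%E.
  apply: le_trans gc; apply: ge0_le_integral => //.
  - by apply/measurable_EFinP; exact: measurableT_comp.
  - exact/measurable_EFinP.
have intf : mu.-integrable D (EFin \o f).
  by apply/integrableP; split; [exact/measurable_EFinP|exact: le_lt_trans fc (ltry _)].
split => //; rewrite -lee_fin; apply: le_trans fc.
rewrite EFin_normr_Rintegral//; apply: le_abse_integral => //.
exact/measurable_EFinP.
Qed.

Lemma integrable_setU (D E : set T) (f : T -> R) : measurable D -> measurable E ->
  [disjoint D & E] -> mu.-integrable D (EFin \o f) -> mu.-integrable E (EFin \o f) ->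
  mu.-integrable (D `|` E) (EFin \o f).
Proof.
move=> mD mE DE /integrableP[mf iD] /integrableP[mg iE].
have mU : measurable_fun (D `|` E) (EFin \o f) by apply/measurable_funU.
apply/integrableP; split => //.
rewrite ge0_integral_setU//; last by apply: measurableT_comp.
exact: lte_add_pinfty.
Qed.

End Domination.

Section Sweeping.
Variable R : realType.
Local Notation P := (R * R)%type.
Local Notation lam := (@lebesgue_measure R).
Variables (mu : {measure set P -> \bar R}) (A p r0 : R) (q : nat).
Hypotheses (A0 : 0 <= A) (r00 : 0 < r0)
  (hA : forall s, 0 <= s -> (mu (cdisc s) <= (A * s `^ p)%:E)%E)
  (h0 : mu (odisc r0) = 0%E) (pq : p < q.+1%:R).

(** The disc of radius [r0] is cut out because negative powers of |z| are unbounded near 0; it is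
    null for [mu]. *)
Definition near_part r : set P := ann r0 (2 * r) `&` @upper R.
Definition far_part r : set P := (@upper R `\` odisc r0) `\` odisc (2 * r).

Lemma measurable_near r : measurable (near_part r).
Proof. by apply: measurableI; [exact: measurable_ann|exact: measurable_upper]. Qed.

Lemma measurable_far r : measurable (far_part r).
Proof.
by do 2 (apply: measurableD; last exact: measurable_odisc); exact: measurable_upper.
Qed.

Lemma near_farU r : @upper R `\` odisc r0 = near_part r `|` far_part r.
Proof.
apply/seteqP; split => z.
  by move=> [uz nz]; have [ino|noto] := pselect (odisc (2 * r) z); [left|right].
by move=> [[[]]|[[]]].
Qed.

Lemma near_far_disj r : [disjoint near_part r & far_part r].
Proof.
by rewrite disj_set2E; apply/eqP/seteqP; split => // z [[[oz _] _] [_ no]].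
Qed.

Lemma measure_near r : 0 < r -> (mu (near_part r) <= (A * 2 `^ p * r `^ p)%:E)%E.
Proof.
move=> r_0; have r2 : 0 <= 2 * r by lra.
apply: (@le_trans _ _ (mu (cdisc (2 * r)))).
  apply: le_measure; rewrite ?inE; [exact: measurable_near|exact: measurable_cdisc|].
  by move=> z [[/(odisc_cdisc r2)]].
by rewrite -mulrA -powRM ?(ltW r_0)//; exact: hA.
Qed.

Lemma measure_near_lty r : 0 < r -> (mu (near_part r) < +oo)%E.
Proof. by move=> /measure_near h; exact: le_lt_trans h (ltry _). Qed.

Lemma integrable_near_ImVX r k : 0 < r ->
  mu.-integrable (near_part r) (EFin \o (fun z : P => complex.Im ((toC z ^+ k)^-1))).
Proof.
move=> r_0; apply: (@bounded_integrable _ _ _ _ _ _ (r0 ^- k)).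
- exact: measurable_near.
- exact: measure_near_lty.
- by apply: (measurable_funS measurableT) => //; exact: measurable_ImVX.
- have r2 : 0 <= 2 * r by lra.
  move=> z [/(in_ann z (ltW r00) r2)/andP[h _] _].
  apply: (le_trans (normr_ImV_le _ _)).
  rewrite lef_pV2 ?posrE ?exprn_gt0 ?(lt_le_trans r00)//.
  by rewrite lerXn2r ?nnegrE ?(ltW r00)// nrm_ge0.
Qed.

Definition near_moment k r : R :=
  Rintegral mu (near_part r) (fun z => complex.Im ((toC z ^+ k)^-1)).

Section Piece.
Variables (r : R) (F : set P).
Hypotheses (r_0 : 0 < r) (mF : measurable F) (Fr : F `<=` cdisc r).

Lemma Pois_le1 z : 0 < z.2 -> Pois z F <= 1.
Proof.
move=> z0; have := @sum_Pois_le1 R z r 1 (fun=> F) z0 r_0 (fun=> mF) (fun=> Fr).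
by rewrite big_ord1; apply => i j; rewrite !ord1 eqxx.
Qed.

Lemma measurable_near_Pois : measurable_fun (near_part r) (fun z => Pois z F).
Proof.
apply: (measurable_funS _ _ (measurable_Pois mF)); first exact: measurable_upper.
by move=> z [].
Qed.

Lemma integrable_near_Pois :
  mu.-integrable (near_part r) (EFin \o (fun z => Pois z F)).
Proof.
apply: (@bounded_integrable _ _ _ _ _ _ 1).
- exact: measurable_near.
- exact: measure_near_lty.
- exact: measurable_near_Pois.
- by move=> z [_ uz]; rewrite ger0_norm ?Pois_ge0// Pois_le1.
Qed.

(** Each correction term is a function of z times a function of [F]. Integrating in z therefore
    leaves the moments themselves, not their absolute values, and the cancellation between the two
    parts of the charge stays available. *)
Lemma near_Omega :
  mu.-integrable (near_part r) (EFin \o (fun z => Omega q z F)) /\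
  Rintegral mu (near_part r) (fun z => Omega q z F) =
  Rintegral mu (near_part r) (fun z => Pois z F) +
  pi^-1 * \sum_(1 <= k < q.+1) near_moment k r * pint k F.
Proof.
have mN := measurable_near r.
have [iS eS] := @Rintegral_sum _ _ _ mu q (near_part r)
  (fun k z => complex.Im ((toC z ^+ k)^-1)) (fun k => pi^-1 * pint k F)
  mN (fun k => integrable_near_ImVX k r_0).
have e : (fun z => Omega q z F) = (fun z => Pois z F +
    \sum_(1 <= k < q.+1) pi^-1 * pint k F * complex.Im ((toC z ^+ k)^-1)).
  apply/funext => z; rewrite OmegaE mulr_sumr; congr (_ + _).
  by apply: eq_bigr => k _; rewrite -mulrA [pint k F * _]mulrC.
have iP := integrable_near_Pois.
rewrite e; split; first exact: (integrableD mN iP iS).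
rewrite RintegralD// eS mulr_sumr; congr (_ + _).
by apply: eq_bigr => k _; rewrite -mulrA [pint k F * _]mulrC.
Qed.

(** The leading 2 comes from [Omega_far]; the rest is the constant of [far_le] with exponent q + 1
    at radius 2 r, after the power of r is taken out. *)
Definition far_cst : R :=
  2 * (gK A p * (1 - 2 `^ (p - q.+1%:R))^-1 * 2 `^ (p - q.+1%:R)).

Lemma far_Omega :
  mu.-integrable (far_part r) (EFin \o (fun z => Omega q z F)) /\
  `|Rintegral mu (far_part r) (fun z => Omega q z F)|
    <= far_cst * (r `^ p / r) * fine (lam (realpart F)).
Proof.
have r2 : 0 < 2 * r by rewrite mulr_gt0.
set l := fine _; have l0 : 0 <= l by rewrite fine_ge0.
apply: (@dominated_integral _ _ _ _ _ _ (fun z => (2 * r ^+ q * l) * nrm z ^- q.+1)).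
- exact: measurable_far.
- apply: (measurable_funS _ _ (measurable_Omega mF q)); first exact: measurable_upper.
  by move=> z [[]].
- apply: measurable_funM => //.
  by apply: (measurable_funS measurableT) => //; exact: measurable_nrmVX.
- move=> z [[uz _] /(in_odisc z (ltW r2)) /negP]; rewrite -leNgt => h.
  have := Omega_far (ltW r_0) mF Fr q uz h; rewrite -/l => /le_trans; apply.
  by rewrite mulrAC.
- have c0 : 0 <= 2 * r ^+ q * l by rewrite !mulr_ge0// exprn_ge0// ltW.
  under eq_integral do rewrite EFinM.
  rewrite ge0_integralZl_EFin//; last 3 first.
  + exact: measurable_far.
  + by move=> z _; exact: EnrmVX_ge0.
  + exact: measurable_EnrmVX.
  have x0 : p - q.+1%:R < 0 by rewrite subr_lt0.
  apply: (@le_trans _ _ ((2 * r ^+ q * l)%:E *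
      (gK A p * (1 - 2 `^ (p - q.+1%:R))^-1 * (2 * r) `^ (p - q.+1%:R))%:E)%E).
    apply: lee_wpmul2l; first by rewrite lee_fin.
    apply: le_trans (far_le A0 hA r2 x0).
    apply: ge0_subset_integral; [exact: measurable_far| | | |].
    + by apply: measurableC; exact: measurable_odisc.
    + exact: measurable_EnrmVX.
    + by move=> z _; exact: EnrmVX_ge0.
    + by move=> z [].
  rewrite -EFinM lee_fin powRM ?(ltW r_0)// [r `^ (_ - _)]powRBn// /far_cst exprS.
  rewrite le_eqVlt; apply/orP; left; apply/eqP.
  have rn : r != 0 by rewrite gt_eqF.
  have rq : r ^+ q != 0 by rewrite expf_neq0.
  set b := 2 `^ _; set a := (1 - b)^-1; clearbody a; move: b => {}b.
  move: (gK A p) (r `^ p) => c e.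
  by field; rewrite rn.
Qed.

(** The near and far parts together miss only the disc of radius [r0] within the half plane, and
    this disc is null. *)
Lemma upper_Omega :
  mu.-integrable (@upper R) (EFin \o (fun z => Omega q z F)) /\
  Rintegral mu (@upper R) (fun z => Omega q z F) =
  Rintegral mu (near_part r) (fun z => Pois z F) +
  pi^-1 * (\sum_(1 <= k < q.+1) near_moment k r * pint k F) +
  Rintegral mu (far_part r) (fun z => Omega q z F).
Proof.
have [iN eN] := near_Omega; have [iF _] := far_Omega.
have mo := @measurable_odisc R r0; have mU := @measurable_upper R.
have mN := measurable_near r; have mFa := measurable_far r.
have dj := near_far_disj r.
have iU := integrable_setU mN mFa dj iN iF.
have iup : mu.-integrable (@upper R) (EFin \o (fun z => Omega q z F)).
  apply/(negligible_integrable mo mU _ h0); last by rewrite (near_farU r).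
  by apply/measurable_EFinP; exact: measurable_Omega.
split => //; rewrite -eN -(Rintegral_setU mN mFa iU dj) -near_farU.
by rewrite /Rintegral (negligible_integral mo mU iup h0).
Qed.

End Piece.

(** Summing before integrating is essential: the sum over the pieces is at most 1 at each z, so only
    the mass of the near part remains. *)
Lemma sum_near_Pois r n (F : 'I_n -> set P) : 0 < r ->
  (forall i, measurable (F i)) -> (forall i, F i `<=` cdisc r) ->
  (forall i j, i != j -> F i `&` F j = set0) ->
  \sum_(i < n) Rintegral mu (near_part r) (fun z => Pois z (F i))
    <= A * 2 `^ p * r `^ p.
Proof.
move=> r_0 mF FD dF.
have mN := measurable_near r.
have iP i := integrable_near_Pois r_0 (mF i) (FD i).
rewrite -lee_fin -sumEFin.
under eq_bigr => i _.
  rewrite /Rintegral fineK; last by apply: integrable_fin_num => //; exact: iP.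
  over.
rewrite -ge0_integral_sum//; last 2 first.
- by move=> i; apply/measurable_EFinP; exact: measurable_near_Pois.
- by move=> i z [_ uz]; rewrite lee_fin Pois_ge0.
under eq_integral do rewrite sumEFin.
apply: (@le_trans _ _ (1%:E * mu (near_part r))%E); last first.
  by rewrite mul1e; exact: measure_near.
apply: integral_le_cst => //.
  by apply: measurable_sum => i; exact: measurable_near_Pois.
move=> z [_ uz]; rewrite (sum_Pois_le1 uz r_0 mF FD dF) andbT.
by apply: sumr_ge0 => i _; exact: Pois_ge0.
Qed.

Lemma near_moment_le k : 0 < p - k%:R ->
  exists2 C, 0 <= C & forall r, 0 < r ->
    `|near_moment k r| <= C * r `^ (p - k%:R).
Proof.
move=> x0; have [C C0 hC] := near_le A0 hA r00 x0.
exists (C * 2 `^ (p - k%:R)); first by rewrite mulr_ge0 ?powR_ge0.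
move=> r r_0; have r2 : 0 < 2 * r by rewrite mulr_gt0.
apply: (dominated_integral (g := fun z => nrm z ^- k) _ _ _ _ _).2.
- exact: measurable_near.
- by apply: (measurable_funS measurableT) => //; exact: measurable_ImVX.
- by apply: (measurable_funS measurableT) => //; exact: measurable_nrmVX.
- by move=> z _; exact: normr_ImV_le.
- rewrite -mulrA -powRM ?(ltW r_0)//.
  apply: le_trans (hC _ r2); apply: ge0_subset_integral.
  + exact: measurable_near.
  + exact: measurable_ann.
  + exact: measurable_EnrmVX.
  + by move=> z _; exact: EnrmVX_ge0.
  + by move=> z [].
Qed.

(* Passing from radius [2 r] to radius [r] costs a single dyadic shell. *)
Lemma near_moment_shell k r : 0 < r ->
  `|near_moment k r - Rintegral mu (ann r0 r `&` @upper R)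
       (fun z => complex.Im ((toC z ^+ k)^-1))| <= gK A p * r `^ (p - k%:R).
Proof.
move=> r_0; have r2 : 0 < 2 * r by rewrite mulr_gt0.
pose S := near_part r `\` odisc r.
have mS : measurable S.
  by apply: measurableD; [exact: measurable_near|exact: measurable_odisc].
have mI : measurable (ann r0 r `&` @upper R).
  by apply: measurableI; [exact: measurable_ann|exact: measurable_upper].
have e : near_part r = (ann r0 r `&` @upper R) `|` S.
  apply/seteqP; split => z.
    move=> zN; have [ino|noto] := pselect (odisc r z); last by right.
    by left; case: zN => -[_ ? ?]; split.
  move=> [|[]//] [/(in_ann z (ltW r00) (ltW r_0))/andP[h1 h2] uz].
  by split => //; apply/in_ann; rewrite ?(ltW r00) ?(ltW r2)// h1 (lt_le_trans h2)//; lra.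
have dj : [disjoint (ann r0 r `&` @upper R) & S].
  by rewrite disj_set2E; apply/eqP/seteqP; split => // z [[[oz _] _] [_ no]].
have iN := integrable_near_ImVX k r_0.
rewrite /near_moment {1}e Rintegral_setU//; last by rewrite -e.
rewrite [X in `|X|]addrC addKr.
apply: (dominated_integral (g := fun z => nrm z ^- k) _ _ _ _ _).2 => //.
- by apply: (measurable_funS measurableT) => //; exact: measurable_ImVX.
- by apply: (measurable_funS measurableT) => //; exact: measurable_nrmVX.
- by move=> z _; exact: normr_ImV_le.
- apply: le_trans (shell_le hA k r_0); apply: ge0_subset_integral => //.
  + exact: measurable_ann.
  + exact: measurable_EnrmVX.
  + by move=> z _; exact: EnrmVX_ge0.
  + by move=> z [[[]]].
Qed.

Lemma inner_moment_le k r c :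
  (\int[mu]_(z in ann r0 r) (nrm z ^- k)%:E <= c%:E)%E ->
  `|Rintegral mu (ann r0 r `&` @upper R) (fun z => complex.Im ((toC z ^+ k)^-1))| <= c.
Proof.
move=> hc.
have mI : measurable (ann r0 r `&` @upper R).
  by apply: measurableI; [exact: measurable_ann|exact: measurable_upper].
apply: (dominated_integral (g := fun z => nrm z ^- k) _ _ _ _ _).2 => //.
- by apply: (measurable_funS measurableT) => //; exact: measurable_ImVX.
- by apply: (measurable_funS measurableT) => //; exact: measurable_nrmVX.
- by move=> z _; exact: normr_ImV_le.
- apply: le_trans hc; apply: ge0_subset_integral => //.
  + exact: measurable_ann.
  + exact: measurable_EnrmVX.
  + by move=> z _; exact: EnrmVX_ge0.
Qed.

End Sweeping.

(** * Sweeping the charge *)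

Section Balayage.
Variable R : realType.
Local Notation P := (R * R)%type.
Local Notation lam := (@lebesgue_measure R).
Variables (mup mun : {measure set P -> \bar R}) (A p r0 : R) (q : nat).
Hypotheses (A0 : 0 <= A) (r00 : 0 < r0)
  (hp : forall s, 0 <= s -> (mup (cdisc s) <= (A * s `^ p)%:E)%E)
  (hn : forall s, 0 <= s -> (mun (cdisc s) <= (A * s `^ p)%:E)%E)
  (zp : mup (odisc r0) = 0%E) (zn : mun (odisc r0) = 0%E)
  (qp : q%:R <= p) (pq : p < q.+1%:R).

Lemma bal_existence : bal_exists mup mun q.
Proof.
(* The radius of a bounded set may be zero or negative here, so it is replaced by a positive one. *)
move=> B mB [r Br]; have s0 : 0 < `|r| + 1 by rewrite ltr_wpDl.
have Bs : B `<=` cdisc (`|r| + 1).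
  apply: (subset_trans Br) => z; rewrite /cdisc /= => /le_trans; apply.
  by rewrite -(real_normK (num_real r)) lerXn2r ?nnegrE// ?lerDl// ltW.
split; [apply: (upper_Omega _ _ hp zp pq s0 mB Bs).1|
        apply: (upper_Omega _ _ hn zn pq s0 mB Bs).1] => //.
Qed.

(** The cutoff in z is 2 r, twice the radius of the disc being estimated, and the parts are
    subtracted before any absolute value is taken. *)
Definition moment k r : R := near_moment mup r0 k r - near_moment mun r0 k r.

Definition near_mass r (F : set P) : R :=
  Rintegral mup (near_part r0 r) (fun z => Pois z F) +
  Rintegral mun (near_part r0 r) (fun z => Pois z F).

Let Cf : R := `|far_cst A p q|.

Lemma measure_cdisc_lty (mu : {measure set P -> \bar R}) r (F : set P) :
  (forall s, 0 <= s -> (mu (cdisc s) <= (A * s `^ p)%:E)%E) -> 0 <= r ->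
  measurable F -> F `<=` cdisc r -> (mu F < +oo)%E.
Proof.
move=> h r_0 mF Fr; apply: le_lt_trans (le_lt_trans (h _ r_0) (ltry _)).
by apply: le_measure; rewrite ?inE//; exact: measurable_cdisc.
Qed.

(** The set [F] enters the bound only through near Poisson mass, length and measure, each of which
    can be summed over disjoint pieces. *)
Lemma normr_bal_le r (F : set P) : 0 < r -> measurable F -> F `<=` cdisc r ->
  `|bal mup mun q F| <= near_mass r F +
    (\sum_(1 <= k < q.+1) `|moment k r| * r ^+ k.-1 + 2 * (Cf * (r `^ p / r)))
      * fine (lam (realpart F)) +
    (fine (mup F) + fine (mun F)).
Proof.
move=> r_0 mF Fr.
have [_ ep] := upper_Omega A0 r00 hp zp pq r_0 mF Fr.
have [_ en] := upper_Omega A0 r00 hn zn pq r_0 mF Fr.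
have [_ fp] := far_Omega r0 A0 hp pq r_0 mF Fr.
have [_ fn] := far_Omega r0 A0 hn pq r_0 mF Fr.
rewrite /bal /chg_int ep en {ep en} /chg /near_mass.
set l := fine (lam _) in fp fn *; have l0 : 0 <= l by rewrite fine_ge0.
have cf : far_cst A p q * (r `^ p / r) * l <= Cf * (r `^ p / r) * l.
  by rewrite ler_wpM2r// ler_wpM2r ?ler_norm// divr_ge0 ?powR_ge0// ltW.
have mD : measurable (F `\` @upper R).
  by apply: measurableD => //; exact: measurable_upper.
have le_mass (mu : {measure set P -> \bar R}) :
    (forall s, 0 <= s -> (mu (cdisc s) <= (A * s `^ p)%:E)%E) ->
    0 <= fine (mu (F `\` @upper R)) <= fine (mu F).
  move=> h; rewrite fine_ge0//=; apply: fine_le.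
  - rewrite ge0_fin_numE//; apply: (measure_cdisc_lty h (ltW r_0)) => //.
    by move=> z [/Fr].
  - by rewrite ge0_fin_numE//; apply: (measure_cdisc_lty h (ltW r_0)).
  - by apply: le_measure; rewrite ?inE// => z [].
have /andP[mp0 mp1] := le_mass mup hp; have /andP[mn0 mn1] := le_mass mun hn.
have ge0 (mu : {measure set P -> \bar R}) :
    0 <= Rintegral mu (near_part r0 r) (fun z => Pois z F).
  by apply: Rintegral_ge0 => z [_ uz]; exact: Pois_ge0.
have pp0 := ge0 mup; have pn0 := ge0 mun.
have eM : pi^-1 * (\sum_(1 <= k < q.+1) near_moment mup r0 k r * pint k F) -
          pi^-1 * (\sum_(1 <= k < q.+1) near_moment mun r0 k r * pint k F) =
          pi^-1 * \sum_(1 <= k < q.+1) moment k r * pint k F.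
  by rewrite -mulrBr -sumrB; congr (_ * _); apply: eq_bigr => k _; rewrite -mulrBl.
have hM : `|pi^-1 * \sum_(1 <= k < q.+1) moment k r * pint k F| <=
    (\sum_(1 <= k < q.+1) `|moment k r| * r ^+ k.-1) * l.
  rewrite normrM ger0_norm ?invr_ge0 ?pi_ge0//.
  apply: (@le_trans _ _ `|\sum_(1 <= k < q.+1) moment k r * pint k F|).
    by rewrite ler_piMl// piV_le1.
  apply: (le_trans (ler_norm_sum _ _ _)); rewrite mulr_suml.
  apply: ler_sum => k _; rewrite normrM -mulrA ler_wpM2l//.
  exact: (abs_pint (ltW r_0) mF Fr k).
move: eM hM.
set Sp := pi^-1 * _; set Sn := pi^-1 * _; set S := pi^-1 * _ => eM.
set SM := \sum_(1 <= k < _) _ => hM.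
move: fp fn pp0 pn0.
set ip := Rintegral mup _ _; set jn := Rintegral mun _ _.
set ap := Rintegral mup _ _; set an := Rintegral mun _ _ => fp fn pp0 pn0.
(* Only the moment terms are combined with their signs; the Poisson, far and lower terms are bounded
   separately for the two parts. *)
have -> : ap + Sp + ip - (an + Sn + jn) +
   (fine (mup (F `\` @upper R)) - fine (mun (F `\` @upper R))) =
  S + (ip - jn) + (ap - an)
   + (fine (mup (F `\` @upper R)) - fine (mun (F `\` @upper R))).
  by rewrite -eM; ring.
have h1 := le_trans fp cf; have h2 := le_trans fn cf.
have e : (SM + 2 * (Cf * (r `^ p / r))) * l =
   SM * l + (Cf * (r `^ p / r) * l + Cf * (r `^ p / r) * l) by ring.
rewrite e {e}.
apply: (le_trans (ler_normD _ _)).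
apply: (@le_trans _ _ (`|S| + (`|ip| + `|jn|) + (ap + an) +
   (fine (mup (F `\` @upper R)) + fine (mun (F `\` @upper R))))).
  apply: lerD.
    apply: (le_trans (ler_normD _ _)); apply: lerD.
      by apply: (le_trans (ler_normD _ _)); rewrite lerD2l ler_normB.
    by rewrite (le_trans (ler_normB _ _))// !ger0_norm.
  by rewrite (le_trans (ler_normB _ _))// !ger0_norm.
move: hM h1 h2 mp1 mn1; clear.
move: `|S| `|ip| `|jn| (SM * l) (Cf * _ * l) (fine _) (fine _) (fine _) (fine _).
move: ap an => *; lra.
Qed.

(** The two parts of the charge give the factors 2 in front of the Poisson and mass constants. The
    total length 2 r doubles the moment sum and turns the far term 2 Cf r^p / r into 4 Cf r^p. *)
Lemma tv_rad_bal_le r : 0 < r ->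
  (tv_rad (bal mup mun q) r <= ((2 * (A * 2 `^ p) + 4 * Cf + 2 * A) * r `^ p +
     2 * \sum_(1 <= k < q.+1) `|moment k r| * r ^+ k)%:E)%E.
Proof.
move=> r_0; apply: ge_ereal_sup => _ [n [F [mF FD dF ->]]].
rewrite lee_fin.
apply: le_trans (ler_sum _ (fun i _ => normr_bal_le r_0 (mF i) (FD i))) _.
pose X := \sum_(1 <= k < q.+1) `|moment k r| * r ^+ k.-1 + 2 * (Cf * (r `^ p / r)).
have -> : \sum_(i < n) (near_mass r (F i) + X * fine (lam (realpart (F i))) +
      (fine (mup (F i)) + fine (mun (F i)))) =
    \sum_(i < n) near_mass r (F i) + X * \sum_(i < n) fine (lam (realpart (F i))) +
    (\sum_(i < n) fine (mup (F i)) + \sum_(i < n) fine (mun (F i))).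
  by rewrite mulr_sumr -!big_split.
rewrite /X {X}.
have hN : \sum_(i < n) near_mass r (F i) <= 2 * (A * 2 `^ p) * r `^ p.
  rewrite big_split/= -mulrA mulrDl mul1r.
  by apply: lerD; apply: sum_near_Pois.
have hm (mu : {measure set P -> \bar R}) :
    (forall s, 0 <= s -> (mu (cdisc s) <= (A * s `^ p)%:E)%E) ->
    \sum_(i < n) fine (mu (F i)) <= A * r `^ p.
  move=> h; have mc := @measurable_cdisc R r.
  have fc := measure_cdisc_lty h (ltW r_0) mc (@subset_refl _ _).
  apply: (le_trans (sum_measure_le mc fc mF FD dF)).
  by rewrite -lee_fin fineK ?ge0_fin_numE//; exact: (h _ (ltW r_0)).
have hl := sum_lam_le (ltW r_0) mF FD dF.
have hp' := hm mup hp; have hn' := hm mun hn.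
set SM := \sum_(1 <= k < _) _.
have SM0 : 0 <= SM + 2 * (Cf * (r `^ p / r)).
  apply: addr_ge0; last first.
    apply: mulr_ge0 => //; apply: mulr_ge0; first exact: normr_ge0.
    by apply: divr_ge0; [exact: powR_ge0|exact: ltW].
  by apply: sumr_ge0 => k _; rewrite mulr_ge0// exprn_ge0// ltW.
have hS := ler_wpM2l SM0 hl.
apply: le_trans (lerD (lerD hN hS) (lerD hp' hn')) _.
(* One factor r of the length raises r^(k-1) to r^k; the index starts at 1, so the truncated
   predecessor is harmless. *)
have eS : SM * r = \sum_(1 <= k < q.+1) `|moment k r| * r ^+ k.
  rewrite mulr_suml; apply: eq_big_nat => k /andP[k1 _].
  by rewrite -mulrA -exprSr prednK.
rewrite -eS le_eqVlt; apply/orP; left; apply/eqP.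
have rn : r != 0 by rewrite gt_eqF.
move: SM Cf (r `^ p) (2 `^ p) {eS SM0 hN hp' hn' hS hm} => a b c e.
by field.
Qed.

Lemma powR_split k r : 0 < r -> r `^ (p - k%:R) * r ^+ k = r `^ p.
Proof. by move=> r_0; rewrite powRBn// divfK// expf_neq0// gt_eqF. Qed.

(** Every index here is strictly below q <= p, so [near_moment_le] applies and r^(p - k) r^k =
    r^p. *)
Lemma low_moments m : (m <= q)%N -> exists2 C, 0 <= C & forall r, 0 < r ->
  \sum_(1 <= k < m) `|moment k r| * r ^+ k <= C * r `^ p.
Proof.
elim: m => [|m IHm] mq.
  by exists 0 => // r r_0; rewrite big_geq// mul0r.
have [C C0 hC] := IHm (ltnW mq).
have [m0|m0] := posnP m.
  by exists 0 => // r r_0; rewrite big_geq ?m0// mul0r.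
have x0 : 0 < p - m%:R.
  by rewrite subr_gt0 (lt_le_trans _ qp)// ltr_nat.
have [Cp Cp0 hCp] := near_moment_le A0 r00 hp x0.
have [Cn Cn0 hCn] := near_moment_le A0 r00 hn x0.
exists (C + (Cp + Cn)); first by rewrite !addr_ge0.
move=> r r_0; rewrite big_nat_recr//= mulrDl lerD ?hC//.
rewrite -(powR_split m r_0) mulrA ler_wpM2r ?exprn_ge0 ?(ltW r_0)//.
by rewrite mulrDl (le_trans (ler_normB _ _))// lerD ?hCp ?hCn.
Qed.

Lemma top_moment r : 0 < r ->
  `|moment q r| * r ^+ q <=
  r ^+ q * `|int_up mup mun q r0 r| + 2 * gK A p * r `^ p.
Proof.
move=> r_0; rewrite -(powR_split q r_0) mulrA mulrC -[X in _ + X]mulrC -mulrDr.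
rewrite ler_wpM2l ?exprn_ge0 ?(ltW r_0)//.
have h1 := near_moment_shell r00 hp q r_0.
have h2 := near_moment_shell r00 hn q r_0.
rewrite /moment /int_up /chg_int -/(ann r0 r).
move: h1 h2; set a := near_moment _ _ _ _; set b := near_moment _ _ _ _.
set c := Rintegral _ _ _; set e := Rintegral _ _ _ => h1 h2.
have -> : a - b = (c - e) + ((a - c) - (b - e)) by ring.
apply: (le_trans (ler_normD _ _)); rewrite lerD2l.
apply: (le_trans (ler_normB _ _)).
by rewrite -mulrA mulrDl mul1r lerD.
Qed.

Lemma chg_int_up_le r c : (\int[mup]_(z in ann r0 r) (nrm z ^- q)%:E <= c%:E)%E ->
  (\int[mun]_(z in ann r0 r) (nrm z ^- q)%:E <= c%:E)%E ->
  `|int_up mup mun q r0 r| <= 2 * c.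
Proof.
move=> /inner_moment_le h1 /inner_moment_le h2.
by rewrite (le_trans (ler_normB _ _))// mulrDl mul1r lerD.
Qed.

(** Radius 0 needs its own argument, the other estimates assuming r > 0: the disc is then a single
    point, of zero length and zero mass. *)
Lemma tv_rad_bal_0 : (tv_rad (bal mup mun q) 0 <= 0)%E.
Proof.
apply: ge_ereal_sup => _ [n [F [mF FD dF ->]]].
rewrite lee_fin big1// => i _.
have l0 : fine (lam (realpart (F i))) = 0.
  apply/eqP; rewrite eq_le fine_ge0// andbT -lee_fin.
  have h := lam_realpart_le (lexx 0) (mF i) (FD i).
  by rewrite fineK ?ge0_fin_numE ?(le_lt_trans h (ltry _))//; rewrite mulr0 in h.
(* For radius 0 every point is far, so the far estimate covers the whole half plane. *)
have O0 z : @upper R z -> Omega q z (F i) = 0.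
  move=> uz; apply/eqP; rewrite -normr_le0.
  have := @Omega_far R 0 (F i) (lexx 0) (mF i) (FD i) q z uz.
  by rewrite l0 !mulr0; apply; exact: nrm_ge0.
have I0 (mu : {measure set P -> \bar R}) :
    Rintegral mu (@upper R) (fun z => Omega q z (F i)) = 0.
  rewrite (@eq_Rintegral _ _ _ _ _ (cst 0)) ?Rintegral_cst ?mul0r//.
    exact: measurable_upper.
  by move=> z /set_mem /O0.
have mD : measurable (F i `\` @upper R).
  by apply: measurableD => //; exact: measurable_upper.
have sD : F i `\` @upper R `<=` odisc r0.
  move=> z [/FD/(in_cdisc z (lexx 0)) h _].
  by apply/(in_odisc z (ltW r00)); exact: le_lt_trans r00.
have mo := @measurable_odisc R r0.
rewrite /bal /chg_int /chg !I0 (subset_measure0 mD mo sD zp).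
by rewrite (subset_measure0 mD mo sD zn) /= !subrr addr0 normr0.
Qed.

Lemma tv_rad_bal_bound : exists2 C, 0 <= C & forall r, 0 <= r ->
  (tv_rad (bal mup mun q) r
     <= (C * (r `^ p + r ^+ q * `|int_up mup mun q r0 r|))%:E)%E.
Proof.
have [C1 C10 hC1] := low_moments (leqnn q).
have gK0 := gK_ge0 p A0.
have Cf0 : 0 <= Cf by exact: normr_ge0.
have P2 : 0 <= A * 2 `^ p by rewrite mulr_ge0 ?powR_ge0.
pose C2 := 2 * (A * 2 `^ p) + 4 * Cf + 2 * A.
have C20 : 0 <= C2 by rewrite /C2; apply: addr_ge0; [apply: addr_ge0|]; apply: mulr_ge0.
(* The last 2 pays for the doubled top moment integral; the other summands collect the coefficients
   of r^p. *)
pose C := C2 + 2 * C1 + 4 * gK A p + 2.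
have C30 : 0 <= C2 + 2 * C1 + 4 * gK A p by apply: addr_ge0; [apply: addr_ge0 => //|]; apply: mulr_ge0.
have C0 : 0 <= C by rewrite addr_ge0.
exists C => // r; rewrite le_eqVlt => /predU1P[<-|r_0].
  by apply: (le_trans tv_rad_bal_0); rewrite lee_fin; apply: mulr_ge0.
apply: (le_trans (tv_rad_bal_le r_0)); rewrite lee_fin -/C2.
set I := r ^+ q * _; have I0 : 0 <= I by rewrite mulr_ge0// exprn_ge0// ltW.
have rp0 := powR_ge0 r p.
have hS : \sum_(1 <= k < q.+1) `|moment k r| * r ^+ k <=
    C1 * r `^ p + (I + 2 * gK A p * r `^ p).
  (* For q = 0 the moment sum is empty, so there is no top term to split off. *)
  case: (posnP q) => q0.
    rewrite big_geq ?q0//; apply: addr_ge0; first exact: mulr_ge0.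
    by apply: addr_ge0 => //; do 2 (apply: mulr_ge0 => //).
  by rewrite big_nat_recr//= lerD ?hC1 ?top_moment.
apply: (@le_trans _ _ (C2 * r `^ p + 2 * (C1 * r `^ p + (I + 2 * gK A p * r `^ p)))).
  by rewrite lerD2l ler_wpM2l.
have -> : C * (r `^ p + I) = C2 * r `^ p + 2 * (C1 * r `^ p + (I + 2 * gK A p * r `^ p))
   + (2 * r `^ p + (C2 + 2 * C1 + 4 * gK A p) * I) by rewrite /C; ring.
by rewrite lerDl addr_ge0// mulr_ge0.
Qed.

End Balayage.

(* nu = mup - mun (Jordan decomposition), q = [p] = Num.truncn p *)
Theorem theorem3 (R : realType) (mup mun : {measure set (R * R)%type -> \bar R})
    (p r0 : R) :
  locfin mup -> locfin mun -> mutsing mup mun ->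
  0 <= p ->
  finite_type (chg mup mun) p ->
  0 < r0 ->
  odisc r0 `&` supp mup mun = set0 ->
  [/\ (bal_exists mup mun (Num.truncn p) /\
       exists C : R, forall r : R, 0 <= r ->
         (tv_rad (bal mup mun (Num.truncn p)) r
          <= (C * (r `^ p + r ^+ Num.truncn p
                     * `|int_up mup mun (Num.truncn p) r0 r|))%:E)%E),
      (exists C : R, \forall r \near +oo,
         (tv_rad (bal mup mun (Num.truncn p)) r <= (C * (r `^ p * ln r))%:E)%E),
      (p \isn't a Num.nat -> finite_type (bal mup mun (Num.truncn p)) p) &
      (p \is a Num.nat ->
       (exists M : R, \forall t \near +oo,
          `|int_up mup mun (Num.truncn p) r0 t| <= M) ->
       finite_type (bal mup mun (Num.truncn p)) p)].
Proof.
move=> lfp lfn ms p0 ft r00 h0.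
have [zp zn] := null_odisc lfp lfn ms r00 h0.
have [A A0 hA] := finite_type_growth lfp lfn ms p0 r00 ft h0.
have hp s : 0 <= s -> (mup (cdisc s) <= (A * s `^ p)%:E)%E by move=> /hA[].
have hn s : 0 <= s -> (mun (cdisc s) <= (A * s `^ p)%:E)%E by move=> /hA[].
have /andP[qp pq] := truncn_itv p0.
set q := Num.truncn p in qp pq *.
have [C C0 hC] := tv_rad_bal_bound A0 r00 hp hn zp zn qp pq.
have split_p r : 0 < r -> r `^ (p - q%:R) * r ^+ q = r `^ p by exact: powR_split.
(* A strict gap between q and p makes the top moment integral O(r^(p - q)), like the lower ones, and
   the factor r^q brings it to r^p. *)
have gap_case : q%:R < p -> finite_type (bal mup mun q) p.
  rewrite -subr_gt0 => x0.
  have [Cp Cp0 hCp] := near_le A0 hp r00 x0.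
  have [Cn Cn0 hCn] := near_le A0 hn r00 x0.
  exists (C * (1 + 2 * (Cp + Cn))); near=> r.
  have r_0 : 0 < r by near: r; exact: nbhs_pinfty_gt.
  apply: (le_trans (hC _ (ltW r_0))); rewrite lee_fin -mulrA ler_wpM2l//.
  rewrite [leRHS]mulrDl mul1r lerD2l.
  have y0 := powR_ge0 r (p - q%:R).
  have hI : `|int_up mup mun q r0 r| <= 2 * ((Cp + Cn) * r `^ (p - q%:R)).
    apply: chg_int_up_le.
      by apply: (le_trans (hCp _ r_0)); rewrite lee_fin ler_wpM2r// lerDl.
    by apply: (le_trans (hCn _ r_0)); rewrite lee_fin ler_wpM2r// lerDr.
  rewrite -(split_p r r_0) [leLHS]mulrC mulrA ler_wpM2r ?exprn_ge0 ?(ltW r_0)//.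
  by rewrite -mulrA.
split.
- split; first exact: (bal_existence A0 r00 hp hn zp zn pq).
  by exists C.
- have [e|ne] := eqVneq (q%:R : R) p; last first.
    have [D] := gap_case ltac:(by rewrite lt_neqAle ne).
    (* The constant [D] may be negative, while passing from r^p to r^p ln r needs a nonnegative
       factor. *)
    move=> hD; exists (Num.max D 0); near=> r.
    have re : expR 1 <= r by near: r; exact: nbhs_pinfty_ge.
    have lr : 1 <= ln r.
      by rewrite -[leLHS](expRK (1 : R)) ler_ln ?posrE ?expR_gt0// (lt_le_trans _ re)// expR_gt0.
    apply: (@le_trans _ _ (D * r `^ p)%:E); first by near: r.
    rewrite lee_fin; apply: (@le_trans _ _ (Num.max D 0 * r `^ p)).
      by rewrite ler_wpM2r ?powR_ge0// le_max lexx.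
    by rewrite ler_wpM2l ?le_max ?lexx ?orbT// ler_peMr ?powR_ge0.
  (* For integer p the shells of the top moment have equal weight, which produces the logarithm. *)
  have x0 : p - q%:R = 0 by rewrite e subrr.
  have [Cp Cp0 hCp] := log_le A0 hp r00 x0.
  have [Cn Cn0 hCn] := log_le A0 hn r00 x0.
  exists (C * (1 + 2 * (Cp + Cn))); near=> r.
  have re : expR 1 <= r by near: r; exact: nbhs_pinfty_ge.
  have r_0 : 0 < r by rewrite (lt_le_trans _ re)// expR_gt0.
  have lr : 1 <= ln r by rewrite -[leLHS](expRK (1 : R)) ler_ln ?posrE ?expR_gt0.
  have lr0 : 0 <= ln r by rewrite (le_trans _ lr).
  have hI : `|int_up mup mun q r0 r| <= 2 * ((Cp + Cn) * ln r).
    apply: chg_int_up_le.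
      by apply: (le_trans (hCp _ re)); rewrite lee_fin ler_wpM2r// lerDl.
    by apply: (le_trans (hCn _ re)); rewrite lee_fin ler_wpM2r// lerDr.
  apply: (le_trans (hC _ (ltW r_0))); rewrite lee_fin -mulrA ler_wpM2l//.
  have -> : r ^+ q = r `^ p by rewrite -e powR_mulrn// ltW.
  rewrite [leRHS]mulrDl mul1r lerD//; first by rewrite ler_peMr ?powR_ge0.
  by rewrite mulrCA ler_wpM2l ?powR_ge0// -mulrA.
- move=> np; apply: gap_case; rewrite lt_neqAle qp andbT.
  by apply: contraNneq np => <-; exact: natr_nat.
- move=> /natrP[m em] [M hM].
  have e : (q%:R : R) = p by rewrite /q em natrK.
  exists (C * (1 + M)); near=> r.
  have r_0 : 0 < r by near: r; exact: nbhs_pinfty_gt.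
  have hI : `|int_up mup mun q r0 r| <= M by near: r.
  apply: (le_trans (hC _ (ltW r_0))); rewrite lee_fin -mulrA ler_wpM2l//.
  have -> : r ^+ q = r `^ p by rewrite -e powR_mulrn// ltW.
  by rewrite mulrDl mul1r lerD2l mulrC ler_wpM2r ?powR_ge0.
Unshelve. all: by end_near. Qed.
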